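(* The non-wandering set of any flow $f^t\in G^-_1(M^3)$ consists of exactly three periodic orbits $S,A,R$: saddle, attracting and repelling, respectively.
   Context: $M^3$ denotes a closed connected orientable 3-manifold. An NMS-flow $f^t\colon M^3\to M^3$ is a non-singular (without fixed points) Morse-Smale flow; its non-wandering set consists of a finite number of hyperbolic periodic orbits. In a tubular neighborhood of a hyperbolic periodic orbit the flow is topologically equivalent to the suspension over a linear diffeomorphism of the plane given by a matrix with positive determinant and real eigenvalues of modulus different from $1$. The orbit is repelling (attracting) if both eigenvalues have modulus greater (less) than $1$, otherwise it is saddle. A saddle orbit is twisted if both eigenvalues are negative. $G^-_1(M^3)$ is the set of NMS-flows on $M^3$ having a single saddle periodic orbit, this orbit being twisted. *)

(* Defs.v *)
From HB Require Import structures.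
From mathcomp Require Import all_boot all_order all_algebra.
From mathcomp Require Import generic_quotient complex.
From mathcomp Require Import all_classical all_reals all_analysis.

Set Implicit Arguments.
Unset Strict Implicit.
Unset Printing Implicit Defensive.

Import Order.TTheory GRing.Theory Num.Theory.
Import numFieldNormedType.Exports.
Local Open Scope classical_set_scope.
Local Open Scope ring_scope.
Local Open Scope quotient_scope.

Section Manifolds.
Context {R : realType}.

(* Manifolds and flows are taken of class C^1, so that every smoothness class
   C^r, 1 <= r <= oo, is covered.
   For maps between finite-dimensional spaces, continuity of each directional
   derivative is continuity of the differential. *)
Definition C1_on {V W : normedModType R} (U : set V) (g : V -> W) : Prop :=
  forall u, U u ->
    differentiable g u /\ forall v, {for u, continuous (fun y => 'd g y v)}.

Record chart (M : Type) := Chart {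
  cdom : set M;
  cmap : M -> 'rV[R]_3;
  cinv : 'rV[R]_3 -> M }.

Definition cimg {M : Type} (c : chart M) : set 'rV[R]_3 := cmap c @` cdom c.

Context {M : topologicalType}.

Definition is_chart (c : chart M) : Prop :=
  [/\ open (cdom c), open (cimg c),
      forall x, cdom c x -> cinv c (cmap c x) = x,
      {within cdom c, continuous (cmap c)} &
      {within cimg c, continuous (cinv c)}].

Definition transition (c d : chart M) (u : 'rV[R]_3) : 'rV[R]_3 :=
  cmap d (cinv c u).

Definition overlap (c d : chart M) : set 'rV[R]_3 :=
  cmap c @` (cdom c `&` cdom d).

Definition C1_atlas (At : set (chart M)) : Prop :=
  [/\ forall c, At c -> is_chart c,
      forall x, exists2 c, At c & cdom c x &
      forall c d, At c -> At d -> C1_on (overlap c d) (transition c d)].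

Definition orientable (At : set (chart M)) : Prop :=
  exists Bt : set (chart M),
    [/\ C1_atlas Bt, C1_atlas (At `|` Bt) &
        forall c d, Bt c -> Bt d -> forall u, overlap c d u ->
          0 < \det ('J (transition c d) u)].

(* Second countability follows from compactness. *)
Definition closed_connected_orientable_3manifold (At : set (chart M)) : Prop :=
  [/\ hausdorff_space M, C1_atlas At, compact [set: M], connected [set: M] &
      orientable At].

End Manifolds.
Arguments chart R M : clear implicits.

Section Flows.
Context {R : realType}.

Definition nonwandering {M : topologicalType} (f : R -> M -> M) : set M :=
  [set x | forall U : set M, nbhs x U ->
     forall T : R, exists2 t, T <= t & f t @` U `&` U !=set0].

Definition nonsingular {M : Type} (f : R -> M -> M) : Prop :=
  forall x, exists t, f t x <> x.

Definition orbit_of {M : Type} (f : R -> M -> M) (x : M) : set M :=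
  range (fun t => f t x).

Definition periodic_orbit {M : Type} (f : R -> M -> M) (O : set M) : Prop :=
  exists x, [/\ exists2 T, 0 < T & f T x = x, exists t, f t x <> x &
                O = orbit_of f x].

Definition least_period {M : Type} (f : R -> M -> M) (x : M) (T : R) : Prop :=
  [/\ 0 < T, f T x = x & forall s, 0 < s < T -> f s x <> x].

(* Only orbit arcs contained in [V] are constrained; [alpha] is the increasing
   change of time along such an arc. *)
Definition carries_arcs {X Y : Type} (f : R -> X -> X) (g : R -> Y -> Y)
    (V : set X) (h : X -> Y) : Prop :=
  forall x t, 0 <= t -> (forall u, 0 <= u <= t -> V (f u x)) ->
    exists alpha : R -> R,
      [/\ alpha 0 = 0,
          {within `[0, t], continuous alpha},
          {in `[0, t] &, {homo alpha : u v / u < v}} &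
          forall u, 0 <= u <= t -> h (f u x) = g (alpha u) (h x)].

(* Equivalence of the restrictions to some open neighbourhoods [V] of [O] and [W]
   of [C]; [V] may be shrunk, and is not required to be invariant. *)
Definition locally_equivalent {X Y : topologicalType}
    (f : R -> X -> X) (O : set X) (g : R -> Y -> Y) (C : set Y) : Prop :=
  exists (V : set X) (W : set Y) (h : X -> Y) (k : Y -> X),
    [/\ open V /\ O `<=` V, open W /\ C `<=` W,
        [/\ h @` V `<=` W, k @` W `<=` V,
            forall x, V x -> k (h x) = x & forall y, W y -> h (k y) = y],
        {within V, continuous h} /\ {within W, continuous k} &
        [/\ h @` O = C, carries_arcs f g V h & carries_arcs g f W k]].

Section Suspension.
Context {X : topologicalType} (a : X -> X).

(* The mapping torus is [X * R] modulo [(x, s) ~ (a x, s - 1)]. *)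
Definition susp_step (z : X * R) : X * R := (a z.1, z.2 - 1).

Definition susp_rel (z w : X * R) : bool :=
  `[< exists m n : nat, iter m susp_step z = iter n susp_step w >].

Lemma susp_rel_refl : reflexive susp_rel.
Proof. by move=> z; apply/asboolP; exists 0%N, 0%N. Qed.

Lemma susp_rel_sym : symmetric susp_rel.
Proof.
by move=> z w; apply/asboolP/asboolP => -[m [n e]]; exists n, m.
Qed.

Lemma susp_rel_trans : transitive susp_rel.
Proof.
move=> w z v /asboolP[m [n e1]] /asboolP[p [q e2]]; apply/asboolP.
by exists (p + m)%N, (n + q)%N; rewrite iterD e1 -iterD addnC iterD e2 -iterD.
Qed.

Canonical susp_equiv := EquivRel susp_rel susp_rel_refl susp_rel_sym susp_rel_trans.

Definition mapping_torus : topologicalType :=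
  quotient_topology {eq_quot susp_equiv}.

Definition susp_pi (z : X * R) : mapping_torus := \pi_({eq_quot susp_equiv}) z.

Definition susp_flow (t : R) (p : mapping_torus) : mapping_torus :=
  let z := repr (p : {eq_quot susp_equiv}) in susp_pi (z.1, z.2 + t).

Lemma susp_flow_pi (t : R) (z : X * R) :
  susp_flow t (susp_pi z) = susp_pi (z.1, z.2 + t).
Proof.
have stepD m (y : X * R) :
    iter m susp_step (y.1, y.2 + t)
    = ((iter m susp_step y).1, (iter m susp_step y).2 + t).
  by elim: m => [//|m IH]; rewrite !iterS IH /susp_step /= addrAC.
have /eqmodP/asboolP[m [n e]] :
    repr (susp_pi z : {eq_quot susp_equiv}) = z %[mod {eq_quot susp_equiv}].
  by rewrite reprK.
by apply/eqmodP/asboolP; exists m, n; rewrite !stepD e.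
Qed.

End Suspension.

Definition linear_plane_map (Q : 'M[R]_2) (x : 'rV[R]_2) : 'rV[R]_2 := x *m Q.

(* [a], [b] are the eigenvalues of [Q], counted with multiplicity. *)
Definition model_matrix (Q : 'M[R]_2) (a b : R) : Prop :=
  [/\ char_poly Q = ('X - a%:P) * ('X - b%:P), 0 < \det Q,
      `|a| != 1 & `|b| != 1].

Definition susp_core (Q : 'M[R]_2) : set (mapping_torus (linear_plane_map Q)) :=
  range (fun s : R => susp_pi (linear_plane_map Q) (0, s)).

Definition linear_model {M : topologicalType} (f : R -> M -> M) (O : set M)
    (a b : R) : Prop :=
  periodic_orbit f O /\
  exists2 Q : 'M[R]_2, model_matrix Q a b &
    locally_equivalent f O (susp_flow (a := linear_plane_map Q))
      (susp_core (Q := Q)).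

Definition repelling_orbit {M : topologicalType} (f : R -> M -> M) (O : set M) :=
  exists a b : R, linear_model f O a b /\ (1 < `|a| /\ 1 < `|b|).

Definition attracting_orbit {M : topologicalType} (f : R -> M -> M) (O : set M) :=
  exists a b : R, linear_model f O a b /\ (`|a| < 1 /\ `|b| < 1).

Definition saddle_orbit {M : topologicalType} (f : R -> M -> M) (O : set M) :=
  exists a b : R, linear_model f O a b /\ (`|a| < 1 /\ 1 < `|b|).

Definition twisted_saddle_orbit {M : topologicalType} (f : R -> M -> M)
    (O : set M) :=
  exists a b : R,
    [/\ linear_model f O a b, `|a| < 1 /\ 1 < `|b| & a < 0 /\ b < 0].

Context {M : topologicalType}.
Implicit Types (At : set (chart R M)) (f : R -> M -> M) (O P : set M).

Definition C1_flow At f : Prop :=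
  [/\ forall x, f 0 x = x,
      forall s t x, f (s + t) x = f s (f t x),
      continuous (fun z : R * M => f z.1 z.2) &
      forall c d, At c -> At d ->
        C1_on [set z : R * 'rV[R]_3 |
                 cimg c z.2 /\ cdom d (f z.1 (cinv c z.2))]
              (fun z => cmap d (f z.1 (cinv c z.2)))].

(* The flow direction contributes the eigenvalue 1 to the differential of the
   period map; hyperbolicity says that this eigenvalue is simple and that there
   is no other complex eigenvalue on the unit circle. *)
Definition hyperbolic_multipliers At f O : Prop :=
  forall (x : M) (T : R) (c : chart R M),
    O x -> least_period f x T -> At c -> cdom c x ->
    let D := 'J (fun u => cmap c (f T (cinv c u))) (cmap c x) in
    mup 1 (char_poly D) = 1%N /\
    forall z : R[i],
      root (map_poly (real_complex R) (char_poly D)) z -> `|z| = 1 -> z = 1.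

(* By the Hartman-Grobman theorem the last clause follows from the first two
   (orientability makes the determinant of the model matrix positive); it is the
   normal form through which the types of orbits are defined. *)
Definition hyperbolic_orbit At f O : Prop :=
  [/\ periodic_orbit f O, hyperbolic_multipliers At f O &
      exists a b : R, linear_model f O a b].

Definition reverse_flow f : R -> M -> M := fun t => f (- t).

Definition stable_set f P : set M :=
  [set x | forall U, open U -> P `<=` U ->
     exists T : R, forall t, T <= t -> U (f t x)].

Definition unstable_set f P : set M := stable_set (reverse_flow f) P.

(* Vectors, read in the chart [c], tangent at [x] to the stable manifold of [P]:
   velocities of curves that are attracted to [P] uniformly. Uniformity makes
   the curve run in the immersed stable manifold for its intrinsic topology. *)
Definition stable_tangent f P (c : chart R M) (x : M) : set 'rV[R]_3 :=
  [set v | exists gamma : R -> 'rV[R]_3, exists2 e : R, 0 < e &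
     [/\ gamma 0 = cmap c x,
         is_derive (0 : R) (1 : R) gamma v,
         forall s, `|s| < e -> cimg c (gamma s) &
         forall U, open U -> P `<=` U ->
           exists T : R, forall t s, T <= t -> `|s| < e ->
             U (f t (cinv c (gamma s)))]].

Definition unstable_tangent f P (c : chart R M) (x : M) : set 'rV[R]_3 :=
  stable_tangent (reverse_flow f) P c x.

Definition transversal_manifolds At f P O : Prop :=
  forall (x : M) (c : chart R M),
    stable_set f P x -> unstable_set f O x -> At c -> cdom c x ->
    forall w : 'rV[R]_3, exists u v,
      [/\ stable_tangent f P c x u, unstable_tangent f O c x v & w = u + v].

Definition NMS_flow At f : Prop :=
  [/\ C1_flow At f, nonsingular f &
      exists Os : set (set M),
        [/\ finite_set Os, forall O, Os O -> hyperbolic_orbit At f O,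
            nonwandering f = \bigcup_(O in Os) O &
            forall P O, Os P -> Os O -> transversal_manifolds At f P O]].

Definition G1_minus At f : Prop :=
  NMS_flow At f /\
  exists S, twisted_saddle_orbit f S /\
    forall O, saddle_orbit f O -> O = S.

End Flows.

(* Main.v *)
Require Import Defs.
From mathcomp Require Import all_boot all_order all_algebra.
From mathcomp Require Import all_classical all_reals all_analysis.
From mathcomp Require Import finmap.
From mathcomp Require Import ring lra zify.
Set Implicit Arguments.
Unset Strict Implicit.
Unset Printing Implicit Defensive.
Import Order.TTheory GRing.Theory Num.Theory.
Import numFieldNormedType.Exports.
Local Open Scope classical_set_scope.
Local Open Scope ring_scope.

(** The closed orbits are finitely many and carry the whole nonwandering set, so
    [M] is the disjoint union of their stable sets ([stable_set_cover],
    [stable_set_unique]). The stable set of an attracting orbit is open, the one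
    of a repelling orbit [O] is [O] itself.

    Let [S] be the twisted saddle. The unstable eigenvalue is negative, so the
    two halves of the unstable axis of [S] lie on the same orbits, and one of
    them meets every orbit of the unstable set other than [S]. Being an interval,
    this half-axis lies in a single basin [stable_set f A], once it is known that
    it contains no homoclinic point, that is, no point of the stable set of [S].
    A point that passes close to [S] off its stable manifold leaves along the
    half-axis, so [stable_set f A] together with [stable_set f S] is open
    ([saddle_basin]). The rest of [M] consists of the other basins, which are
    open too, and of the repelling orbits. Removing these closed curves does not
    disconnect [M], because a punctured disc is connected
    ([repeller_one_side]). Hence [A] is the only attracting orbit
    ([unique_attractor]); applied to the reversed flow the same argument gives
    the only repelling orbit.

    Homoclinic points are excluded in two steps.
    - They form an open and closed subset of the half-axis
      ([saddle_homoclinic_open], [saddle_homoclinic_all]). Otherwise there would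
      be a homoclinic point [z] and points of the axis arbitrarily close to [z]
      that return close to [S], but off the stable manifold. As the return point
      varies continuously, its height above the stable manifold takes all small
      values of one sign; because of the twist one of them leads back to [z]
      itself, and [z] would be nonwandering.
    - If all points of the half-axis were homoclinic, then every orbit leaving
      [S] close to the unstable set would come back close to [S]; so orbits would
      cross a neighbourhood of a compact fundamental domain of the axis any given
      number of times ([saddle_no_homoclinic]). But that domain consists of
      wandering points, and a compact set of wandering points has a neighbourhood
      that no orbit visits often ([bounded_visits]).

    The local normal forms enter through [tube]: a solid torus around a closed
    orbit, cut open along a disc and glued by a plane map [T]
    ([tube_of_equivalence]). In suitable linear coordinates [T] is a contraction,
    the inverse of one, or diagonal ([linear_model_tube]). *)

(** * Continuous flows and their closed orbits *)

Definition continuous_flow {R : realType} {M : topologicalType}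
    (f : R -> M -> M) : Prop :=
  [/\ forall x, f 0 x = x, forall s t x, f (s + t) x = f s (f t x) &
      continuous (fun z : R * M => f z.1 z.2)].

Lemma clopen_interval {R : realType} (D P1 P2 : set R) x y :
  is_interval D ->
  (forall z, D z -> P1 z \/ P2 z) -> (forall z, P1 z -> P2 z -> False) ->
  (forall z, D z -> P1 z -> \near z, P1 z) ->
  (forall z, D z -> P2 z -> \near z, P2 z) ->
  D x -> D y -> P1 x -> P1 y.
Proof.
move=> /connected_intervalP cD cov dis o1 o2 Dx Dy P1x.
suff E : D `&` P1 = D by move: Dy; rewrite -E => -[].
apply: cD; first by exists x.
- exists (interior P1); first exact: open_interior.
  by apply/seteqP; split=> z [Dz P]; split=> //; [apply: o1|apply: interior_subset].
- exists (~` (interior P2)); first by apply: open_closedC; exact: open_interior.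
  apply/seteqP; split=> z [Dz P]; split=> //.
    by move=> /interior_subset; apply: dis.
  by case: (cov z Dz) => // P2z; case: P; apply: o2.
Qed.

Section FlowBasics.
Context {R : realType} {M : topologicalType} (f : R -> M -> M).
Hypothesis fl : continuous_flow f.

Let f0 x : f 0 x = x. Proof. by case: fl. Qed.
Let fD s t x : f (s + t) x = f s (f t x). Proof. by case: fl. Qed.
Let fc : continuous (fun z : R * M => f z.1 z.2). Proof. by case: fl. Qed.

Lemma flowK t : cancel (f t) (f (- t)).
Proof. by move=> x; rewrite -fD addNr f0. Qed.

Lemma flowNK t : cancel (f (- t)) (f t).
Proof. by move=> x; rewrite -fD addrN f0. Qed.

Lemma flow_continuous t : continuous (f t).
Proof.
move=> x; apply: (@continuous_comp _ _ _ (fun y : M => (t, y))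
  (fun z : R * M => f z.1 z.2)); last exact: fc.
exact: (cvg_pair (cvg_cst _) cvg_id).
Qed.

Lemma flow_continuousl x : continuous (f ^~ x).
Proof.
move=> t; apply: (@continuous_comp _ _ _ (fun s : R => (s, x))
  (fun z : R * M => f z.1 z.2)); last exact: fc.
exact: (cvg_pair cvg_id (cvg_cst _)).
Qed.

Lemma continuous_flow_reverse : continuous_flow (reverse_flow f).
Proof.
rewrite /reverse_flow; split=> [x|s t x|]; first by rewrite oppr0.
  by rewrite opprD fD.
move=> z; apply: (@continuous_comp _ _ _ (fun z : R * M => (- z.1, z.2))
  (fun z : R * M => f z.1 z.2)); last exact: fc.
exact: (cvg_pair (continuous_comp (@cvg_fst _ _ _ _ _) (@oppr_continuous _ _ _)) (@cvg_snd _ _ _ _ _)).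
Qed.

Lemma reverse_flowK : reverse_flow (reverse_flow f) = f.
Proof. by apply/funext=> t; rewrite /reverse_flow opprK. Qed.

Lemma nonwandering_reverse : nonwandering (reverse_flow f) = nonwandering f.
Proof.
apply/seteqP; split=> x H U xU T; have [t Tt [y [[z Uz zy] Uy]]] := H U xU T;
  exists t => //; exists z; split=> //; exists y => //; rewrite -zy.
  by rewrite /reverse_flow flowNK.
by rewrite /reverse_flow flowK.
Qed.

Lemma flow_nbhs t x U : nbhs (f t x) U -> \forall y \near x, U (f t y).
Proof. exact: flow_continuous. Qed.

Section Orbit.
Variable O : set M.
Hypothesis pO : periodic_orbit f O.

Lemma periodic_flow t y : O y -> O (f t y).
Proof.
by case: pO => x [_ _ ->] [s _ <-]; exists (t + s) => //; rewrite fD.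
Qed.

Lemma periodic_flowE t y : O (f t y) -> O y.
Proof. by move=> /(periodic_flow (- t)); rewrite flowK. Qed.

Lemma periodic_orbitE y : O y -> O = orbit_of f y.
Proof.
case: pO => x [_ _ ->] [s _ <-]; apply/seteqP; split=> _ [t _ <-].
  by exists (t - s) => //; rewrite -fD subrK.
by exists (t + s) => //; rewrite fD.
Qed.

Lemma periodic_orbit_neq0 : O !=set0.
Proof. by case: pO => x [_ _ ->]; exists (f 0 x); exists 0. Qed.

Lemma periodic_nonwandering : O `<=` nonwandering f.
Proof.
case: (pO) => x [[T T0 fT] _ OE] y Oy U yU T1.
have pT n : f (T *+ n) x = x.
  by elim: n => [|n IH]; rewrite ?mulr0n// mulrSr fD fT IH.
have pTy n : f (T *+ n) y = y.
  move: Oy; rewrite OE => -[s _ <-].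
  by rewrite -fD addrC fD pT.
pose n := (Num.truncn (`|T1| / T)).+1.
exists (T *+ n).
  rewrite -mulr_natr -ler_pdivrMl// mulrC.
  apply: (le_trans (ler_wpM2r _ (ler_norm _))); first by rewrite invr_ge0 ltW.
  by apply/ltW/truncnS_gt.
by exists y; split; [exists y => //; exact: nbhs_singleton|exact: nbhs_singleton].
Qed.

Lemma periodic_compact : compact O.
Proof.
case: pO => x [[T T0 fT] _ ->].
have pT n : f (T *+ n) x = x.
  by elim: n => [|n IH]; rewrite ?mulr0n// mulrSr fD fT IH.
have pTi (m : int) : f (T *~ m) x = x.
  case: m => n; rewrite ?NegzE -?pmulrn ?pT//.
  by rewrite -nmulrn -[in LHS](pT n.+1) flowK.
suff -> : orbit_of f x = (f ^~ x) @` `[0, T].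
  apply: continuous_compact; last exact: segment_compact.
  by apply: continuous_subspaceT => t; exact: flow_continuousl.
apply/seteqP; split=> [_ [t _ <-]|_ [t _ <-]]; last by exists t.
pose m := Num.floor (t / T).
exists (t - T *~ m); last by rewrite fD -mulrNz pTi.
rewrite /= in_itv /= subr_ge0 lerBlDr -mulrzr.
rewrite mulrC -ler_pdivlMr// ge_floor/=.
have -> : T + m%:~R * T = (m%:~R + 1) * T by rewrite mulrDl mul1r addrC.
rewrite -ler_pdivrMr//.
by apply/ltW; rewrite -[1]/(1%:~R) -intrD floorD1_gt.
Qed.

End Orbit.

Lemma periodic_orbit_eq O P y :
  periodic_orbit f O -> periodic_orbit f P -> O y -> P y -> O = P.
Proof.
by move=> pO pP Oy Py; rewrite (periodic_orbitE pO Oy) (periodic_orbitE pP Py).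
Qed.

Lemma stable_set_flow P t x : stable_set f P (f t x) <-> stable_set f P x.
Proof.
split=> H U oU PU; have [T HT] := H U oU PU.
  by exists (T + t) => s Ts; rewrite -(subrK t s) fD; apply: HT; lra.
by exists (T - t) => s Ts; rewrite -fD; apply: HT; lra.
Qed.

End FlowBasics.

Lemma periodic_orbit_reverse {R : realType} {M : topologicalType}
    (f : R -> M -> M) O : continuous_flow f ->
  periodic_orbit f O -> periodic_orbit (reverse_flow f) O.
Proof.
move=> fl [x [[T T0 fT] [t ft] ->]]; exists x; split.
- by exists T => //; rewrite /reverse_flow -{1}fT (flowK fl).
- exists (- t); rewrite /reverse_flow opprK//.
- by apply/seteqP; split=> _ [s _ <-]; exists (- s) => //;
    rewrite /reverse_flow opprK.
Qed.

(** * Every orbit converges to exactly one closed orbit *)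

Record finite_orbit_flow {R : realType} {M : topologicalType} (f : R -> M -> M)
    (Os : set (set M)) : Prop := {
  fo_flow : continuous_flow f;
  fo_hausdorff : hausdorff_space M;
  fo_compact : compact [set: M];
  fo_finite : finite_set Os;
  fo_periodic : forall O, Os O -> periodic_orbit f O;
  fo_nonwandering : nonwandering f = \bigcup_(O in Os) O }.

Section Limits.
Context {R : realType} {M : topologicalType} (f : R -> M -> M) (Os : set (set M)).
Hypothesis G : finite_orbit_flow f Os.
Let fl := fo_flow G.

Lemma finite_orbit_flow_reverse : finite_orbit_flow (reverse_flow f) Os.
Proof.
case: (G) => ? ? ? ? per ?; split=> //.
- exact: continuous_flow_reverse.
- by move=> O /per; exact: periodic_orbit_reverse.
- by rewrite nonwandering_reverse.
Qed.

Lemma closed_orbit_closed O : Os O -> closed O.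
Proof.
move=> /(fo_periodic G) pO; apply: compact_closed; first exact: fo_hausdorff G.
exact: (periodic_compact fl).
Qed.

Lemma closed_orbits_closed (Ps : set (set M)) :
  Ps `<=` Os -> closed (\bigcup_(O in Ps) O).
Proof.
move=> PO; apply: closed_bigcup => [|O /PO]; last exact: closed_orbit_closed.
exact: sub_finite_set (fo_finite G).
Qed.

Lemma closed_orbit_unique O P y : Os O -> Os P -> O y -> P y -> O = P.
Proof. move=> /(fo_periodic G) pO /(fo_periodic G); exact: periodic_orbit_eq. Qed.

(** A wandering point cannot be revisited infinitely often. *)
Lemma recurrent_nonwandering x (C : set M) : closed C ->
  (forall T, exists2 t, T <= t & C (f t x)) ->
  exists y, [/\ C y, nonwandering f y &
    forall V, nbhs y V -> forall T, exists2 t, T <= t & V (f t x)].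
Proof.
move=> cC rec.
pose F : set_system M := (f ^~ x) @ within (fun t => C (f t x)) +oo%R.
have FE (A : set M) T : (forall t, T <= t -> C (f t x) -> A (f t x)) -> F A.
  move=> H; rewrite /F /= /fmap /within /=; exists T; split; first exact: num_real.
  by move=> t Tt; apply: H; exact: ltW.
have FP : ProperFilter F.
  apply: Build_ProperFilter_ex => A [T [_ HA]].
  by have [t Tt Ct] := rec (T + 1); exists (f t x); apply: HA => //; lra.
have [y [_ yF]] := fo_compact G FP filterT.
have vis V : nbhs y V -> forall T, exists2 t, T <= t & V (f t x).
  move=> yV T.
  have [z [[t [Tt zE _]] Vz]] := yF [set z | exists t, [/\ T <= t, z = f t x & C z]] V
    (FE _ T (fun t Tt Ct => ex_intro _ t (And3 Tt erefl Ct))) yV.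
  by exists t => //; rewrite -zE.
exists y; split=> //.
  apply: cC => V yV.
  by apply: yF => //; apply: (FE _ 0).
move=> U yU T; have [t1 _ U1] := vis U yU 0.
have [t2 t12 U2] := vis U yU (t1 + T).
exists (t2 - t1); first lra.
exists (f t2 x); split=> //; exists (f t1 x) => //.
by case: fl => _ <- _; rewrite subrK.
Qed.

(** The limit set of a point lies in the disjoint union of the closed orbits;
    as a half-line of times is connected, the orbit cannot jump infinitely often
    from a neighbourhood of one of them to a neighbourhood of the others. *)
Lemma stable_set_cover x : exists2 O, Os O & stable_set f O x.
Proof.
have [y0 [_ + vis]] := @recurrent_nonwandering x setT closedT
   (fun T => ex_intro2 _ _ T (lexx T) I).
rewrite (fo_nonwandering G); case=> O OsO Oy0; exists O => //.
pose C := \bigcup_(P in Os `\ O) P.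
have cC : closed C by apply: closed_orbits_closed => P [].
have OC0 : O `&` C = set0.
  apply/seteqP; split=> // z [Oz [P [OsP PO] Pz]]; apply: PO.
  exact: closed_orbit_unique Pz Oz.
have nC : set_nbhs O (~` C).
  apply/set_nbhsP; exists (~` C); split=> //; first exact: closed_openC.
  by move=> z Oz Cz; have : (O `&` C) z by []; rewrite OC0.
have [V /set_nbhsP[U1 [oU1 OU1 U1V]] clV] :=
  compact_normal (fo_hausdorff G) (fo_compact G) (closed_orbit_closed OsO) nC.
pose U2 := ~` closure V.
have oU2 : open U2 by apply: closed_openC; exact: closed_closure.
have CU2 : C `<=` U2 by move=> z Cz /clV; exact.
have dU z : U1 z -> U2 z -> False.
  by move=> /U1V Vz; apply; exact: subset_closure.
have OsE z : nonwandering f z -> O z \/ C z.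
  rewrite (fo_nonwandering G) => -[P OsP Pz].
  by have [<-|PO] := pselect (P = O); [left|right; exists P].
have [T0 HT0] : exists T0, forall t, T0 <= t -> U1 (f t x) \/ U2 (f t x).
  apply/not_existsP => H.
  have [|T|z [/not_orP[nU1 nU2] nz _]] :=
      @recurrent_nonwandering x [set z | ~ (U1 z \/ U2 z)].
  - by rewrite -openC setCK; exact: openU.
  - by have /existsNP[t /not_implyP[? ?]] := H T; exists t.
  - by case: (OsE z nz) => [/OU1|/CU2].
have [t1 T01 Ut1] := vis U1 (open_nbhs_nbhs (conj oU1 (OU1 _ Oy0))) T0.
have U1t t : t1 <= t -> U1 (f t x).
  move=> t1t.
  apply: (@clopen_interval R `[t1, +oo[ [set s | U1 (f s x)] [set s | U2 (f s x)] t1).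
  - exact: interval_is_interval.
  - by move=> s; rewrite /= in_itv /= andbT => ?; apply: HT0; lra.
  - by move=> s; exact: dU.
  - by move=> s _ Us; apply: (flow_continuousl fl); exact: open_nbhs_nbhs.
  - by move=> s _ Us; apply: (flow_continuousl fl); exact: open_nbhs_nbhs.
  - by rewrite /= in_itv /= lexx.
  - by rewrite /= in_itv /= t1t.
  - exact: Ut1.
move=> U oU OU; apply/not_existsP => H.
have [|T|z [nUz nz visz]] := @recurrent_nonwandering x (~` U).
- exact: open_closedC.
- by have /existsNP[t /not_implyP[? ?]] := H T; exists t.
case: (OsE z nz) => [/OU //|Cz].
have [t t1t U2t] := visz U2 (open_nbhs_nbhs (conj oU2 (CU2 _ Cz))) t1.
exact: dU (U1t t t1t) U2t.
Qed.

Lemma stable_set_orbit O y : Os O -> O y -> stable_set f O y.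
Proof.
move=> OsO Oy U oU OU; exists 0 => t _; apply: OU.
exact: (periodic_flow fl (fo_periodic G OsO)).
Qed.

Lemma stable_set_unique O P x :
  Os O -> Os P -> stable_set f O x -> stable_set f P x -> O = P.
Proof.
move=> OsO OsP xO xP; apply: contrapT => OP.
have nO : set_nbhs O (~` P).
  apply/set_nbhsP; exists (~` P); split=> //.
    by apply: closed_openC; exact: closed_orbit_closed.
  by move=> z Oz Pz; apply: OP; exact: closed_orbit_unique Oz Pz.
have [V /set_nbhsP[U [oU OU UV]] clV] :=
  compact_normal (fo_hausdorff G) (fo_compact G) (closed_orbit_closed OsO) nO.
have [T1 H1] := xO U oU OU.
have [|z Pz /clV /(_ Pz)//|T2 H2] := xP (~` closure V).
  exact/closed_openC/closed_closure.
have := H1 (Num.max T1 T2); rewrite le_max lexx => /(_ isT) /UV /subset_closure.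
by apply: H2; rewrite le_max lexx orbT.
Qed.

(** An orbit converging to [O] stays away from the other closed orbits after some
    time, and before that time it runs along a compact arc. *)
Lemma stable_set_accumulation O P x y : Os O -> Os P -> stable_set f O x ->
  P y -> (forall V, nbhs y V -> exists2 t, 0 <= t & V (f t x)) -> O = P.
Proof.
move=> OsO OsP xO Py acc; apply: contrapT => OP.
have Py' : ~ O y by move=> Oy; apply: OP; exact: closed_orbit_unique Oy Py.
have nO : set_nbhs O (~` [set y]).
  apply/set_nbhsP; exists (~` [set y]); split=> //; last first.
    by move=> z Oz /= zy; apply: Py'; rewrite -zy.
  by apply/closed_openC/accessible_closed_set1/hausdorff_accessible/(fo_hausdorff G).
have [V /set_nbhsP[U [oU OU UV]] clV] :=
  compact_normal (fo_hausdorff G) (fo_compact G) (closed_orbit_closed OsO) nO.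
have [T HT] := xO U oU OU.
have cK : compact ((f ^~ x) @` `[0, T]).
  apply: continuous_compact; last exact: segment_compact.
  by apply: continuous_subspaceT => t; exact: (flow_continuousl fl).
have Ky : closure ((f ^~ x) @` `[0, T]) y.
  move=> W yW.
  have [t t0 [Wt Vt]] := acc _ (filterI yW (open_nbhs_nbhs
    (conj (closed_openC (@closed_closure _ V)) (fun h => clV y h erefl)))).
  exists (f t x); split=> //; exists t => //=; rewrite in_itv /= t0 /= leNgt.
  by apply/negP => /ltW /HT /UV /subset_closure.
have [t _ fty] := compact_closed (fo_hausdorff G) cK Ky.
apply/OP/(stable_set_unique OsO OsP xO)/(stable_set_orbit OsP).
by apply: (periodic_flowE fl (fo_periodic G OsP) (t := t)); rewrite fty.
Qed.

End Limits.

(** * Wandering sets are visited a bounded number of times *)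

(** The times of the visits are nonnegative and at least [T] apart: this is what
    allows a visit to be compared with an earlier one through the definition of a
    wandering point. *)
Definition visits {R : realType} {M : Type} (f : R -> M -> M) (T : R)
    (F : set M) (n : nat) (x : M) : Prop :=
  exists tau : nat -> R,
    (forall i, (i < n)%N -> 0 <= tau i /\ F (f (tau i) x)) /\
    (forall i j, (i < j)%N -> (j < n)%N -> tau i + T <= tau j).

(** Cover the compact curve by finitely many sets [U] that no orbit re-enters
    later than some time. With visits far enough apart and more visits than sets,
    two visits fall in the same [U]. *)
Lemma bounded_visits {R : realType} {M : topologicalType} (f : R -> M -> M)
    (g : R -> M) (J : set R) : continuous_flow f -> compact J ->
  (forall y, J y -> {for y, continuous g}) ->
  (forall y, J y -> ~ nonwandering f (g y)) ->
  exists F T n, [/\ open F, forall y, J y -> F (g y), 0 <= T &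
    forall x, ~ visits f T F n x].
Proof.
move=> fl cJ cg wJ.
have /choice[U HU] : forall y, exists p : set M * R, J y ->
    [/\ open p.1, p.1 (g y) &
        forall t z, p.2 <= t -> p.1 z -> ~ p.1 (f t z)].
  move=> y; have [Jy|nJy] := pselect (J y); last by exists (setT, 0).
  have /existsNP[U /not_implyP[+ /existsNP[T HT]]] := wJ y Jy.
  rewrite nbhsE => -[V [oV Vy] VU]; exists (V, T) => _; split=> //= t z Tt /VU Uz /VU Uf.
  by apply: HT; exists t => //; exists (f t z); split=> //; exists z.
have [s sJ cov] : exists2 s : seq R, (forall k, k \in s -> J k) &
    forall y, J y -> exists2 k, k \in s & (U k).1 (g y).
  move: cJ; rewrite compact_cover => /(_ R J (fun y => interior (g @^-1` (U y).1))).
  case=> [i _||D' D'J cov]; first exact: open_interior.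
    move=> y Jy; exists y => //; have [oU Uy _] := HU y Jy.
    by apply: (cg y Jy); exact: open_nbhs_nbhs.
  exists (enum_fset D') => [k kD'|y /cov[k kD' /interior_subset Uy]].
    exact: set_mem (D'J k kD').
  by exists k.
pose T := \sum_(k <- s) `|(U k).2|.
exists (\bigcup_(k in [set` s]) (U k).1), T, (size s).+1; split.
- by apply: bigcup_open => k /sJ/HU[].
- by move=> y /cov[k ks Uy]; exists k.
- exact: sumr_ge0.
move=> x [tau [tauF tauT]].
have /choice[k Hk] : forall i : 'I_(size s).+1, exists k : 'I_(size s),
    (U (nth 0 s k)).1 (f (tau i) x).
  move=> i; have [_ [k ks Uk]] := tauF i (ltn_ord i).
  have ki : (index k s < size s)%N by rewrite index_mem.
  by exists (Ordinal ki); rewrite /= nth_index.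
have [i [j [ij kij]]] : exists i j : 'I_(size s).+1, (i < j)%N /\ k i = k j.
  apply: contrapT => H; have : injective k.
    move=> i j kE; apply: ord_inj.
    by case: (ltngtP i j) => // ij; case: H; [exists i, j|exists j, i].
  by move=> /leq_card; rewrite !card_ord ltnn.
have ks : nth 0 s (k i) \in s by exact: mem_nth.
have [_ _ /(_ (tau j - tau i) (f (tau i) x))] := HU _ (sJ _ ks).
case: fl => _ fD _; rewrite -fD subrK; apply => //; last by rewrite kij.
have := tauT i j ij (ltn_ord j); rewrite -lerBrDl; apply: le_trans.
rewrite /T (big_rem _ ks)/=.
by apply: (le_trans (ler_norm _)); rewrite lerDl; exact: sumr_ge0.
Qed.

(** * Tubes around closed orbits *)

(** [Phi] parametrizes a solid torus around [O], the last coordinate running along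
    the flow, so that one turn acts on the disc of radius [r] by [T]. The range
    of the last coordinate exceeds one turn on both sides of [0]: the relation
    between [s] and [s + 1] and the injectivity on slices of length less than [1]
    then make sense around every point of [O], and the definition is symmetric
    under reversal of time. *)
Record tube {R : realType} {M : topologicalType} (f : R -> M -> M) (O : set M)
    (T : R * R -> R * R) (r : R) (Phi : (R * R) * R -> M) : Prop := {
  tube_gt0 : 0 < r;
  tube_continuous : forall (p : R * R) (s : R), `|p| < r -> -2 < s < 2 ->
    {for (p, s), continuous Phi};
  tube_open : forall (p : R * R) (s : R) U, `|p| < r -> -2 < s < 2 -> nbhs (p, s) U ->
    nbhs (Phi (p, s)) (Phi @` U);
  tube_step : forall (p : R * R) (s : R), `|p| < r -> `|T p| < r -> - 2 < s -> s < 1 ->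
    Phi (p, s + 1) = Phi (T p, s);
  tube_arc : forall (p : R * R) (s s' : R), `|p| < r -> - 2 < s -> s <= s' -> s' < 2 ->
    exists2 t, 0 <= t & Phi (p, s') = f t (Phi (p, s));
  tube_core : forall (p : R * R) (s : R), `|p| < r -> -2 < s < 2 -> O (Phi (p, s)) <-> p = 0;
  tube_surj : forall y, O y -> exists2 s, -1 < s < 1 & y = Phi (0, s);
  tube_inj : forall (p q : R * R) (s u : R), `|p| < r -> `|q| < r -> -2 < s < 2 -> -2 < u < 2 ->
    -1 < s - u < 1 -> Phi (p, s) = Phi (q, u) -> p = q /\ s = u }.

Lemma geometric_lt {R : realType} (k c e : R) :
  0 <= k -> k < 1 -> 0 < e -> exists N, forall n, (N <= n)%N -> k ^+ n * c < e.
Proof.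
move=> k0 k1 e0.
have c0 : 0 < `|c| + 1 by have := normr_ge0 c; lra.
have /cvgrPdist_lt/(_ _ (divr_gt0 e0 c0))[N _ HN] : k ^+ n @[n --> \oo] --> 0.
  by apply: cvg_expr; rewrite ger0_norm.
exists N => n /HN /=; rewrite sub0r normrN ger0_norm ?exprn_ge0// ltr_pdivlMr//.
apply: le_lt_trans; apply: ler_wpM2l; first exact: exprn_ge0.
by have := ler_norm c; lra.
Qed.

Section TubeFacts.
Context {R : realType} {M : topologicalType} (f : R -> M -> M).
Context (O : set M) (T : R * R -> R * R) (r : R) (Phi : (R * R) * R -> M).
Hypothesis tb : tube f O T r Phi.

Definition tube_box (e : R) : set M :=
  Phi @` [set z | `|z.1| < e /\ -1 < z.2 < 1].

Lemma tube_box_nbhs e y : 0 < e -> e <= r -> O y -> nbhs y (tube_box e).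
Proof.
move=> e0 er /(tube_surj tb)[s s1 ->]; apply: (tube_open tb).
- by rewrite normr0; exact: lt_le_trans er.
- lra.
- exists ([set p | `|p| < e], [set s | -1 < s < 1]) => //=; split => /=.
    by apply/nbhs_ballP; exists e => //= q; rewrite -ball_normE /= sub0r normrN.
  suff: \near s, s \in `](-1), 1[ by apply: filterS => u; rewrite in_itv.
  by apply: near_in_itvoo; rewrite in_itv.
Qed.

Lemma tube_interior_box e : 0 < e -> e <= r -> O `<=` interior (tube_box e).
Proof. by move=> e0 er y; exact: tube_box_nbhs. Qed.

Lemma tube_core0 s : -2 < s < 2 -> O (Phi (0, s)).
Proof. by move=> s2; apply/(tube_core tb) => //; rewrite normr0 (tube_gt0 tb). Qed.

Lemma tube_inj0 p q s : `|p| < r -> `|q| < r -> -1 < s < 1 ->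
  Phi (p, s) = Phi (q, 0) -> p = q.
Proof. by move=> pr qr s1 /(tube_inj tb)[] //; lra. Qed.

Lemma tube_small V q : `|q| < r -> nbhs (Phi (q, 0)) V ->
  exists2 e, 0 < e & forall p, `|p - q| < e -> V (Phi (p, 0)).
Proof.
move=> qr V0.
have : \forall p \near q, V (Phi (p, 0)).
  apply: (@continuous_comp _ _ _ (fun p : R * R => (p, 0 : R)) Phi q) V0.
    exact: (cvg_pair cvg_id (cvg_cst _)).
  by apply: (tube_continuous tb) => //; lra.
move=> /nbhs_ballP[e /= e0 He]; exists e => // p pe; apply: He.
by rewrite -ball_normE /= distrC.
Qed.

End TubeFacts.

(** A point of the stable set of [O] enters every neighbourhood of [O], and an
    invariant set that is a neighbourhood of [f t x] is one of [x]. *)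
Lemma invariant_nbhs {R : realType} {M : topologicalType} (f : R -> M -> M)
    (O W : set M) x : continuous_flow f ->
  (forall t y, W (f t y) -> W y) -> (forall y, O y -> nbhs y W) ->
  stable_set f O x -> nbhs x W.
Proof.
move=> fl inv OW xO.
have [T HT] := xO (interior W) (@open_interior _ _) OW.
have := flow_nbhs fl (HT T (lexx T)).
by apply: filterS => y; exact: inv.
Qed.

(** [T'] is the inverse of [T]. A repelling orbit is one with an attracting tube
    for the reversed flow; the Lipschitz bound on [T'] is then what keeps an
    expanding orbit from jumping over a fundamental annulus. *)
Definition attracting_tube {R : realType} {M : topologicalType}
    (f : R -> M -> M) (O : set M) : Prop :=
  exists (T T' : R * R -> R * R) (r k L : R) (Phi : (R * R) * R -> M),
    [/\ cancel T' T, 0 < k < 1, forall p, `|T p| <= k * `|p|,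
        forall p, `|T' p| <= L * `|p| & tube f O T r Phi].

Section Attractors.
Context {R : realType} {M : topologicalType} (f : R -> M -> M) (Os : set (set M)).
Hypothesis G : finite_orbit_flow f Os.
Let fl := fo_flow G.
Let f0 x : f 0 x = x. Proof. by case: fl. Qed.
Let fD s t x : f (s + t) x = f s (f t x). Proof. by case: fl. Qed.

(** A point of the tube comes at each turn to the iterates of its disc coordinate
    under the contraction, hence accumulates on the core. *)
Lemma attracting_tube_open O : Os O -> attracting_tube f O ->
  open (stable_set f O).
Proof.
move=> OsO [T [T' [r [k [L [Phi [_ /andP[k0 k1] Tk _ tb]]]]]]].
have r0 := tube_gt0 tb.
rewrite openE => x xO; apply: (invariant_nbhs fl _ _ xO).
  by move=> t y; rewrite (stable_set_flow fl).
move=> y Oy; apply: filterS (tube_box_nbhs tb r0 (lexx r) Oy).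
move=> _ [[p s] /= [pr s1] <-]; set z := Phi _.
have TnS n : `|iter n T p| <= k ^+ n * `|p|.
  elim: n => [|n IH]; first by rewrite expr0 mul1r.
  rewrite iterS; apply: (le_trans (Tk _)).
  by rewrite exprS -mulrA ler_pM2l.
have Tn n : `|iter n T p| < r.
  apply: le_lt_trans (TnS n) _; apply: le_lt_trans pr.
  by rewrite ler_piMl// exprn_ile1// ltW.
have reach n : exists2 t, 0 <= t & f t z = Phi (iter n.+1 T p, 0).
  elim: n => [|n [t t0 tE]].
    have [|||t t0 tE] := tube_arc tb pr (s := s) (s' := 1); [lra|lra|lra|].
    exists t => //; rewrite -tE -[1]add0r (tube_step tb)//; try lra.
    exact: (Tn 1).
  have [|||u u0 uE] := tube_arc tb (Tn n.+1) (s := 0) (s' := 1); [lra|lra|lra|].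
  exists (u + t); first lra.
  rewrite fD tE -uE -[1]add0r (tube_step tb)//; try lra.
  exact: (Tn n.+2).
have [P OsP zP] := stable_set_cover G z.
suff <- : P = O by [].
apply: (stable_set_accumulation G OsP OsO zP (tube_core0 tb (s := 0) _)).
  lra.
move=> V V0; have [|e e0 He] := tube_small tb _ V0; first by rewrite normr0.
have [N HN] := geometric_lt `|p| (ltW k0) k1 e0.
have [t t0 tE] := reach N; exists t => //; rewrite tE; apply: He.
rewrite subr0; apply: le_lt_trans (TnS _) _; exact: HN.
Qed.

(** Outside a repelling orbit every forward orbit crosses a fundamental domain
    of the expansion, at a definite distance from the orbit. *)
Lemma repelling_stable_set O : Os O -> attracting_tube (reverse_flow f) O ->
  stable_set f O `<=` O.
Proof.
move=> OsO [T [T' [r [k [L [Phi [TT' /andP[k0 k1] Tk T'L tb]]]]]]] x xO.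
have r0 := tube_gt0 tb.
have T'k q : `|q| <= k * `|T' q| by rewrite -{1}(TT' q).
have L0 : 1 <= L.
  have q1 : `|((1, 0) : R * R)| = 1.
    by rewrite prod_normE /= normr1 normr0; apply/max_idPl.
  have := T'k (1, 0); have := T'L (1, 0); rewrite q1 mulr1 => h1 h2.
  rewrite -(ler_pM2l k0) mulr1; apply: le_trans (ltW k1) _.
  by apply: le_trans h2 _; rewrite ler_pM2l.
(* A point of radius less than [r1] is moved by [T'] to radius at most [r / 2]. *)
pose r1 := r / (2 * L).
have r10 : 0 < r1 by rewrite divr_gt0// mulr_gt0//; lra.
have Lr1 : L * r1 = r / 2 by rewrite /r1; field; lra.
have r1r : r1 <= r / 2 by rewrite -Lr1 ler_peMl// ltW.
have r2r : r / 2 < r by lra.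
have r1r' : r1 <= r by lra.
have [t Ht] := xO _ (@open_interior _ _)
  (tube_interior_box tb r10 r1r').
have [[p s] /= [pr s1] pE] := interior_subset (Ht t (lexx t)).
have [p0|pN0] := eqVneq p 0.
  apply: (periodic_flowE fl (fo_periodic G OsO) (t := t)).
  by rewrite -pE p0; apply: (tube_core0 tb); lra.
exfalso.
have back q : `|q| < r1 -> forall s, -1 < s < 1 ->
    exists2 u, 0 <= u & f u (Phi (q, s)) = Phi (T' q, 0).
  move=> qr1 s' s'1; have qr : `|q| < r by lra.
  have [|||u u0 uE] := tube_arc tb qr (s := -1) (s' := s'); [lra|lra|lra|].
  exists u => //; rewrite uE /reverse_flow (flowNK fl).
  rewrite -[in RHS](addNr 1) (tube_step tb) ?TT'//; try lra.
  apply: (le_lt_trans (T'L q)); apply: le_lt_trans r2r.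
  by rewrite -Lr1 ler_pM2l ?ltW//; lra.
have [n [u [u0 uE nr1 nr2]]] : exists n u, [/\ 0 <= u,
    f u (Phi (p, s)) = Phi (iter n.+1 T' p, 0), r1 <= `|iter n.+1 T' p| &
    `|iter n.+1 T' p| < r].
  have T'n n : `|p| <= k ^+ n * `|iter n T' p|.
    elim: n => [|n IH]; first by rewrite expr0 mul1r.
    apply: (le_trans IH); rewrite exprSr -mulrA ler_pM2l ?exprn_gt0//.
  have ex : exists n, r1 <= `|iter n T' p|.
    apply/not_existsP => H.
    have p0 : 0 < `|p| by rewrite normr_gt0.
    have [N /(_ N (leqnn N)) HN] := geometric_lt r1 (ltW k0) k1 p0.
    have := lt_le_trans HN (T'n N); rewrite ltr_pM2l ?exprn_gt0//.
    by move=> /ltW; exact: H.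
  have [[|n] Hn minn] := ex_minnP ex; first by move: Hn; rewrite /= leNgt pr.
  have lt m : (m <= n)%N -> `|iter m T' p| < r1.
    by move=> mn; rewrite ltNge; apply/negP => /minn; rewrite ltnNge mn.
  exists n.
  have [u u0 uE] : exists2 u, 0 <= u & f u (Phi (p, s)) = Phi (iter n.+1 T' p, 0).
    elim: (n) lt => [|m IH] lt'; first exact: back.
    have [u u0 uE] := IH (fun i im => lt' i (leqW im)).
    have [|v v0 vE] := back _ (lt' _ (leqnn _)) 0; first lra.
    by exists (v + u); [lra|rewrite fD uE vE].
  exists u; split=> //.
  rewrite iterS; apply: (le_lt_trans (T'L _)); apply: le_lt_trans r2r.
  by rewrite -Lr1 ler_pM2l ?ltW ?lt//; lra.
have tut : t <= u + t by lra.
have [[q s'] /= [qr1 s'1] qE1] := interior_subset (Ht (u + t) tut).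
have qr : `|q| < r by lra.
have qE : q = iter n.+1 T' p.
  by apply: (tube_inj0 tb qr nr2 s'1); rewrite qE1 fD -pE uE.
by move: nr1; rewrite -qE leNgt qr1.
Qed.

End Attractors.

(** * Saddle tubes *)

Lemma ltr_norm_pair {R : realType} (x y e : R) :
  (`|(x, y) : R * R| < e) = (`|x| < e) && (`|y| < e).
Proof. by rewrite prod_normE /= gt_max. Qed.

Lemma nbhs_pair {X Y : topologicalType} (x : X) (y : Y) A B :
  nbhs x A -> nbhs y B -> nbhs (x, y) [set z | A z.1 /\ B z.2].
Proof. by move=> xA yB; exists (A, B). Qed.

Lemma nbhs_itvoo {R : realType} (a b x : R) : a < x < b ->
  nbhs x [set y | a < y < b].
Proof.
move=> axb; suff : \near x, x \in `]a, b[ by apply: filterS => u; rewrite in_itv.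
by apply: near_in_itvoo; rewrite in_itv.
Qed.

Lemma nbhs_norm_lt {R : realType} (e x : R) : `|x| < e ->
  nbhs x [set y | `|y| < e].
Proof.
by rewrite ltr_norml => /nbhs_itvoo; apply: filterS => y /=; rewrite ltr_norml.
Qed.

Definition saddle_map {R : realType} (a b : R) (p : R * R) : R * R :=
  (a * p.1, b * p.2).

Definition twisted_saddle_tube {R : realType} {M : topologicalType}
    (f : R -> M -> M) (O : set M) : Prop :=
  exists a b r Phi,
    [/\ -1 < a < 0, b < -1 & tube f O (saddle_map a b) r Phi].

(** The twist: the levels [y / b ^+ n] tend to [0] and change sign at each step, so
    some of them lie between [0] and [v] whatever the sign of [v]. *)
Lemma alternating_levels {R : realType} (b y v : R) N : b < -1 -> 0 < y ->
  v != 0 -> exists2 n, (N <= n)%N &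
    0 < y / b ^+ n < v \/ v < y / b ^+ n < 0.
Proof.
move=> b1 y0 vN0; pose c := - b; have c1 : 1 < c by rewrite /c; lra.
have bE : b = - c by rewrite opprK.
have ci0 : 0 <= c^-1 by rewrite invr_ge0; lra.
have ci1 : c^-1 < 1 by rewrite invf_lt1; lra.
have v0 : 0 < `|v| by rewrite normr_gt0.
have [N' HN'] := geometric_lt y ci0 ci1 v0.
(* The parity of [n] is chosen so that [b ^+ n] has the sign of [v]. *)
pose n := ((v < 0)%R + 2 * maxn N N')%N.
have N'n : (N' <= n)%N by rewrite /n; lia.
have ylt : y / c ^+ n < `|v| by rewrite mulrC -exprVn; exact: HN'.
have yc : 0 < y / c ^+ n by rewrite divr_gt0// exprn_gt0//; lra.
have bnE : b ^+ n = (-1) ^+ (v < 0)%R * c ^+ n.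
  have nodd : odd n = (v < 0) by rewrite /n oddD mul2n odd_double addbF oddb.
  by rewrite bE [LHS]exprNn -nodd signr_odd.
exists n; first by rewrite /n; lia.
rewrite bnE.
case: (boolP (v < 0)) => vs /=; [right|left].
  by rewrite expr1 mulN1r invrN mulrN; rewrite (ltr0_norm vs) in ylt; lra.
rewrite -leNgt in vs; rewrite expr0 mul1r; rewrite (ger0_norm vs) in ylt; lra.
Qed.

Section Saddle.
Context {R : realType} {M : topologicalType} (f : R -> M -> M) (Os : set (set M)).
Hypothesis G : finite_orbit_flow f Os.
Context (S : set M) (a b r : R) (Phi : (R * R) * R -> M).
Hypotheses (OsS : Os S) (a01 : -1 < a < 0) (b1 : b < -1).
Hypothesis tb : tube f S (saddle_map a b) r Phi.

Let fl := fo_flow G.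
Let f0 x : f 0 x = x. Proof. by case: fl. Qed.
Let fD s t x : f (s + t) x = f s (f t x). Proof. by case: fl. Qed.
Let r0 : 0 < r := tube_gt0 tb.
(* The heights between [rho] and [b ^+ 2 * rho] form a fundamental domain of two
   turns around [S], the least number of turns that preserves the sign. The factor
   [2] keeps this domain inside the disc of radius [r]. *)
Let rho := r / (2 * b ^+ 2).
Let bb1 : 1 < b ^+ 2. Proof. by move: b1 => h; rewrite expr2; nra. Qed.
Let rho0 : 0 < rho.
Proof. by move: bb1 => h; rewrite /rho divr_gt0//; lra. Qed.
Let rhor : b ^+ 2 * rho = r / 2.
Proof. by rewrite /rho; field; rewrite /=; apply/eqP => b0; move: b1; rewrite b0 => h; lra. Qed.
Let Nb1 : 1 < `|b|. Proof. by move: b1 => h; rewrite ltr0_norm; lra. Qed.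
Let Na1 : `|a| < 1. Proof. by move: a01 => h; rewrite ltr0_norm; lra. Qed.
Let rho_lt : rho < r.
Proof.
have : 0 < (b ^+ 2 - 1) * rho by rewrite mulr_gt0// subr_gt0.
by move: rhor r0 => h1 h2; rewrite mulrBl h1; lra.
Qed.
Local Ltac slra :=
  have := (a01); have := (b1); have := (r0); have := (bb1); have := (rho0);
  have := (rhor); have := (rho_lt); have := (Nb1); have := (Na1);
  do 9! [move=> ?]; lra.

Lemma saddle_reach n x y s : -1 < s < 1 -> `|x| < r -> `|b ^+ n.+1 * y| < r ->
  exists2 t, 0 <= t &
    f t (Phi ((x, y), s)) = Phi ((a ^+ n.+1 * x, b ^+ n.+1 * y), 0).
Proof.
have step x' y' s' : -1 < s' < 1 -> `|x'| < r -> `|b * y'| < r ->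
    exists2 t, 0 <= t & f t (Phi ((x', y'), s')) = Phi ((a * x', b * y'), 0).
  move=> s1 xr byr.
  have yr : `|y'| < r.
    by apply: le_lt_trans byr; rewrite normrM ler_peMl// ltW.
  have axr : `|a * x'| < r.
    by apply: le_lt_trans xr; rewrite normrM ler_piMl// ltW.
  have pr : `|(x', y')| < r by rewrite ltr_norm_pair xr.
  have [|||t t0 tE] := tube_arc tb pr (s := s') (s' := 1); [slra|slra|slra|].
  exists t => //; rewrite -tE -[1]add0r (tube_step tb)//; try slra.
  by rewrite /saddle_map /= ltr_norm_pair axr.
move=> s1 xr; elim: n => [|n IH] byr; first by rewrite !expr1; apply: step; rewrite -1?[b]expr1.
have byr' : `|b ^+ n.+1 * y| < r.
  by apply: le_lt_trans byr; rewrite [_ ^+ n.+2]exprS -mulrA [leRHS]normrM ler_peMl// ltW.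
have [t t0 tE] := IH byr'.
have axr : `|a ^+ n.+1 * x| < r.
  by apply: le_lt_trans xr; rewrite normrM normrX ler_piMl// exprn_ile1// ltW.
have [||u u0 uE] := step _ (b ^+ n.+1 * y) 0 _ axr; first slra.
  by rewrite mulrA -exprS.
by exists (u + t); [slra|rewrite fD tE uE !mulrA -!exprS].
Qed.

Let exit_time y : 0 < `|y| -> `|y| < rho ->
  exists n, rho <= b ^+ n.+1 * y <= b ^+ 2 * rho.
Proof.
have main z : 0 < z -> z < rho ->
    exists m, (0 < m)%N /\ rho <= (b ^+ 2) ^+ m * z <= b ^+ 2 * rho.
  move=> z0 zr.
  have ex : exists m, rho <= (b ^+ 2) ^+ m * z.
    have bi0 : 0 <= (b ^+ 2)^-1 by rewrite invr_ge0; slra.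
    have bi1 : (b ^+ 2)^-1 < 1 by rewrite invf_lt1; slra.
    have [N /(_ N (leqnn N)) HN] := geometric_lt rho bi0 bi1 z0.
    have b2N : 0 < (b ^+ 2) ^+ N by rewrite exprn_gt0//; slra.
    exists N; move: HN; rewrite exprVn mulrC ltr_pdivrMr//.
    by rewrite mulrC => /ltW.
  have [[|m] Hm minm] := ex_minnP ex.
    by move: Hm; rewrite expr0 mul1r leNgt zr.
  exists m.+1; split=> //; rewrite Hm /= exprS -mulrA ler_pM2l; last slra.
  by rewrite leNgt; apply/negP => /ltW/minm; rewrite ltnn.
move=> y0 yr.
have [yp|yn] := ltP 0 y.
  have [|m [m0 Hm]] := main y yp; first by move: yr; rewrite gtr0_norm.
  exists (2 * m).-1; rewrite prednK ?muln_gt0//.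
  by rewrite exprM.
have yn' : y < 0 by rewrite lt_neqAle yn andbT -normr_gt0.
have by0 : 0 < b * y by rewrite nmulr_rgt0//; slra.
have yr' : - y < rho by rewrite -ltr0_norm.
have [byr|byr] := ltP (b * y) rho.
  have [m [m0 Hm]] := main _ by0 byr.
  by exists (2 * m)%N; rewrite exprSr -mulrA exprM.
exists 0%N; rewrite expr1 byr /= expr2 -mulrA.
move: b1 => b1'; nra.
Qed.

(** A point close to the stable manifold makes many turns before its height
    reaches the fundamental domain, and meanwhile it is contracted towards the
    unstable axis. Negative heights become positive after one turn, so the
    positive half of the axis suffices. *)
Lemma saddle_exit (d : R) : 0 < d -> exists e, [/\ 0 < e, e <= rho &
  forall x y s, `|x| < r -> 0 < `|y| -> `|y| < e -> -1 < s < 1 ->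
    exists t x' y', [/\ 0 <= t, `|x'| < d, rho <= y' <= b ^+ 2 * rho &
      f t (Phi ((x, y), s)) = Phi ((x', y'), 0)]].
Proof.
move=> d0.
have [N HN] := geometric_lt r (normr_ge0 a) Na1 d0.
have bN : 1 <= `|b| ^+ N by rewrite exprn_ege1// ltW.
exists (rho / `|b| ^+ N); split.
- by rewrite divr_gt0//; slra.
- by rewrite ler_pdivrMr ?ler_peMr//; [exact: ltW|slra].
move=> x y s xr y0; rewrite ltr_pdivlMr; last slra.
move=> ye s1.
have yr : `|y| < rho.
  by apply: le_lt_trans ye; rewrite ler_peMr.
have [n Hn] := exit_time y0 yr.
have nN : (N <= n.+1)%N.
  rewrite leqNgt; apply/negP => nN.
  have : `|b ^+ n.+1 * y| <= `|y| * `|b| ^+ N.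
    rewrite normrM normrX mulrC ler_pM2l// ler_eXn2l//; exact: ltnW.
  have := ler_norm (b ^+ n.+1 * y); slra.
have [|t t0 tE] := saddle_reach (n := n) (y := y) s1 xr.
  by rewrite ger0_norm; slra.
exists t, (a ^+ n.+1 * x), (b ^+ n.+1 * y); split=> //.
apply: le_lt_trans (HN _ nN); rewrite normrM normrX.
by apply: ler_wpM2l; [exact: exprn_ge0|exact: ltW].
Qed.

(** An orbit that stays close to [S] has height [0]: otherwise [saddle_exit] would
    take it to a height at least [rho], outside the box. *)
Lemma saddle_landing z e t0 : stable_set f S z -> 0 < e -> e <= rho ->
  exists t x, [/\ t0 <= t, `|x| < e & f t z = Phi ((x, 0), 0)].
Proof.
move=> zS e0 er.
have [e1 [e10 e1r He1]] := saddle_exit r0.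
pose e2 := Num.min e e1.
have e20 : 0 < e2 by rewrite lt_min e0.
have e2e : e2 <= e by rewrite ge_min lexx.
have e2e1 : e2 <= e1 by rewrite ge_min lexx orbT.
have e2r : e2 <= r by slra.
have [T HT] := zS _ (@open_interior _ _) (tube_interior_box tb e20 e2r).
pose t1 := Num.max t0 T.
have Tt1 : T <= t1 by rewrite le_max lexx orbT.
have [[[x y] s] /= [+ s1] pE] := interior_subset (HT t1 Tt1).
rewrite ltr_norm_pair => /andP[xe ye].
have [y0|yN0] := eqVneq y 0.
  rewrite y0 in pE.
  have [|||u u0 uE] := @saddle_reach 0 x 0 s; [by []|slra|by rewrite mulr0 normr0|].
  exists (u + t1), (a ^+ 1 * x); split.
  - by have : t0 <= t1 by [rewrite le_max lexx]; slra.
  - by apply: lt_le_trans e2e; apply: le_lt_trans xe; rewrite expr1 normrM ler_piMl// ltW.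
  - by rewrite fD -pE uE mulr0.
exfalso.
have [||||t [x' [y' [tt x'r /andP[y'1 y'2] tE]]]] := He1 x y s; try slra.
  by rewrite normr_gt0.
have Tt : T <= t + t1 by slra.
have [[[x2 y2] s2] /= [+ s21] qE] := interior_subset (HT _ Tt).
rewrite ltr_norm_pair => /andP[x2e y2e].
have x2r : `|(x2, y2)| < r by rewrite ltr_norm_pair; slra.
have y'r : `|(x', y')| < r.
  by rewrite ltr_norm_pair x'r /= ger0_norm; slra.
have [_ y2E] : (x2, y2) = (x', y').
  by apply: (tube_inj0 tb x2r y'r s21); rewrite qE fD -pE tE.
by move: y2e; rewrite y2E ger0_norm; slra.
Qed.

Let axis y := Phi ((0, y), 0).

Lemma saddle_stable_axis x s : `|x| < r -> -1 < s < 1 ->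
  stable_set f S (Phi ((x, 0), s)).
Proof.
move=> xr s1; have [P OsP zP] := stable_set_cover G (Phi ((x, 0), s)).
suff <- : P = S by [].
have s02 : -2 < (0 : R) < 2 by lra.
apply: (stable_set_accumulation G OsP OsS zP (tube_core0 tb s02)) => V V0.
have [|e e0 He] := tube_small tb _ V0; first by rewrite normr0.
have [N /(_ N.+1 (leqnSn N)) HN] := geometric_lt `|x| (normr_ge0 a) Na1 e0.
have [|t t0 tE] := saddle_reach (n := N) (y := 0) s1 xr.
  by rewrite mulr0 normr0.
exists t => //; rewrite tE; apply: He.
by rewrite mulr0 subr0 ltr_norm_pair normr0 e0 normrM normrX HN.
Qed.

(** Backwards in time the point tends to [S]; a closed orbit through it would
    therefore meet [S]. *)
Lemma saddle_unstable_axis_wandering y : 0 < y < r -> ~ nonwandering f (axis y).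
Proof.
move=> /andP[y0 yr]; rewrite (fo_nonwandering G); case=> O OsO Oy.
have yr' : `|y| < r by rewrite gtr0_norm.
have bN0 : b != 0 by apply/eqP => b0; move: Nb1; rewrite b0 normr0 ltr10.
have OS : O = S.
  have s02 : -2 < (0 : R) < 2 by lra.
  apply: (closed_orbit_unique G OsO OsS (y := Phi (0, 0))); last exact: (tube_core0 tb).
  apply: (closed_orbit_closed G OsO) => V V0.
  have [|e e0 He] := tube_small tb _ V0; first by rewrite normr0.
  have bi0 : 0 <= `|b|^-1 by rewrite invr_ge0.
  have bi1 : `|b|^-1 < 1 by rewrite invf_lt1//; slra.
  have [N /(_ N.+1 (leqnSn N)) HN] := geometric_lt y bi0 bi1 e0.
  have [|||t t0 tE] := @saddle_reach N 0 (b ^- N.+1 * y) 0.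
  - lra.
  - by rewrite normr0.
  - by rewrite mulrA divff ?mul1r// expf_neq0.
  exists (Phi ((0, b ^- N.+1 * y), 0)); split.
    apply: (periodic_flowE fl (fo_periodic G OsO) (t := t)).
    by rewrite tE mulr0 mulrA divff ?mul1r// expf_neq0.
  apply: He; rewrite subr0 ltr_norm_pair normr0 e0 normrM normfV normrX.
  by rewrite (gtr0_norm y0) -exprVn HN.
have s02 : -2 < (0 : R) < 2 by lra.
have pr : `|(0 : R, y)| < r by rewrite ltr_norm_pair normr0 r0.
by move: Oy; rewrite OS => /(tube_core tb pr s02)[]; lra.
Qed.

Let axis_flow_near t y0 V : 0 < y0 < r -> nbhs (f t (axis y0)) V ->
  \forall y \near y0, V (f t (axis y)).
Proof.
move=> y0r /(flow_nbhs fl) Vy.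
have pr : `|(0 : R, y0)| < r.
  by rewrite ltr_norm_pair normr0 r0 gtr0_norm; slra.
have [e e0 He] := tube_small tb pr Vy.
apply/nbhs_ballP; exists e => // y /=; rewrite -ball_normE /= => ye.
apply: He; have -> : (0 : R, y) - (0, y0) = (0, y - y0) by congr pair; rewrite subr0.
by rewrite ltr_norm_pair normr0 e0 distrC.
Qed.

(** * Homoclinic points of the saddle *)

(** Let [f t1] take [axis y0] to the stable manifold, and consider the height of
    [f t1 (axis y)] above it for [y] near [y0]. Were it nonzero somewhere, it would
    take by connectedness some value [y0 / b ^ n]; such a point returns after [n]
    turns to a neighbourhood of [axis y0], which would then be nonwandering. *)
Lemma saddle_homoclinic_open y0 : 0 < y0 < r -> stable_set f S (axis y0) ->
  \forall y \near y0, stable_set f S (axis y).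
Proof.
move=> y0r y0S; have /andP[y00 y0r'] := y0r.
have /existsNP[U /not_implyP[U0 /existsNP[T HT]]] :=
  saddle_unstable_axis_wandering y0r.
have wander t z : T <= t -> U z -> ~ U (f t z).
  by move=> Tt Uz Uft; apply: HT; exists t => //; exists (f t z); split=> //; exists z.
have pr : `|(0 : R, y0)| < r by rewrite ltr_norm_pair normr0 r0 gtr0_norm.
have [d d0 Hd] := tube_small tb pr U0.
have [t1 [x1 [Tt1 x1rho x1E]]] := saddle_landing T y0S rho0 (lexx rho).
have x1r : `|x1| < r by slra.
have [N1 HN1] := geometric_lt r (normr_ge0 a) Na1 d0.
(* The points of the tube near the slice [s = 0] with height in [A]. The slice is
   no thicker than one turn, so the height is well defined there. *)
pose B (A : set R) := Phi @` [set z | [set p | `|p| < r /\ A p.2] z.1 /\ - 2^-1 < z.2 < 2^-1].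
have Bnbhs (A : set R) x v s : `|x| < r -> `|v| < r -> - 2^-1 < s < 2^-1 ->
    nbhs v A -> nbhs (Phi ((x, v), s)) (B A).
  move=> xr vr s1 vA; apply: (tube_open tb); [by rewrite ltr_norm_pair xr|lra|].
  suff rA : nbhs (x, v) [set p | `|p| < r /\ A p.2].
    exact: (nbhs_pair rA (nbhs_itvoo s1)).
  apply: filterS (nbhs_pair (nbhs_norm_lt xr) (filterI (nbhs_norm_lt vr) vA)).
  by move=> [x' v'] /= [? [? ?]]; rewrite ltr_norm_pair; split=> //; apply/andP.
have BE A z : B A z -> exists x v s,
    [/\ `|x| < r, `|v| < r, - 2^-1 < s < 2^-1, A v & z = Phi ((x, v), s)].
  by move=> [[[x v] s] /= [[+ ? ?]] <-]; rewrite ltr_norm_pair => /andP[? ?]; exists x, v, s.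
have : \forall y \near y0, 
    [/\ U (axis y), B setT (f t1 (axis y)) & 0 < y < r].
  suff: \forall y \near y0, (U (axis y) /\ B setT (f t1 (axis y))) /\ 0 < y < r.
    by apply: filterS => y [[]].
  apply: filterI; last exact: nbhs_itvoo.
  apply: filterI; last first.
    apply: axis_flow_near => //; rewrite x1E.
    by apply: Bnbhs; [|rewrite normr0|lra|exact: filterT].
  have U0' : nbhs (f 0 (axis y0)) U by rewrite f0.
  by apply: filterS (axis_flow_near y0r U0') => y; rewrite f0.
move=> /nbhs_ballP[e /= e0 He].
have v0 y x v s : ball y0 e y -> `|x| < r -> `|v| < r -> - 2^-1 < s < 2^-1 ->
    f t1 (axis y) = Phi ((x, v), s) -> v = 0.
  move=> ye xr vr s1 yE; apply: contrapT => /eqP vN0.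
  have [[//|n] N1n] := alternating_levels N1.+1 b1 y00 vN0.
  set l := y0 / _ => l_between.
  have lE : b ^+ n.+1 * l = y0.
    rewrite /l mulrCA divff ?mulr1// expf_neq0//.
    by apply/eqP => b0; move: b1; rewrite b0 => ?; lra.
  (* Below and above the level [l], for the height of [f t1 (axis z)]. *)
  pose P1 := [set z | B [set u | u < l] (f t1 (axis z))].
  pose P2 := [set z | B [set u | l < u] (f t1 (axis z))].
  have near_level (A : set R) z : open A -> ball y0 e z ->
      B A (f t1 (axis z)) -> \forall z \near z, B A (f t1 (axis z)).
    move=> oA ze; have [_ _ z0r] := He z ze.
    move=> /BE[x' [v' [s' [x'r v'r s'1 Av' zE]]]].
    apply: axis_flow_near => //; rewrite zE; apply: Bnbhs => //.
    exact: open_nbhs_nbhs.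
  have cover z : ball y0 e z -> P1 z \/ P2 z.
    move=> ze; have [Uz + _] := He z ze.
    move=> /BE[x' [v' [s' [x'r v'r s'1 _ zE]]]].
    have BA (A : set R) : A v' -> B A (f t1 (axis z)).
      move=> Av'; exists ((x', v'), s') => //=.
      by rewrite ltr_norm_pair x'r.
    case: (ltrgtP v' l) => v'l; [left; exact: BA|right; exact: BA|].
    exfalso.
    have [|||t t0 tE] := @saddle_reach n x' l s'; [lra|by []|by rewrite lE gtr0_norm|].
    apply: (wander (t + t1) (axis z)) => //; first by lra.
    rewrite fD zE v'l tE lE; apply: Hd.
    have -> : (a ^+ n.+1 * x', y0) - (0, y0) = (a ^+ n.+1 * x', 0).
      by congr pair; rewrite ?subr0 ?subrr.
    rewrite ltr_norm_pair normr0 d0 andbT normrM normrX.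
    have ar : `|a| ^+ n.+1 * r < d by apply: HN1; exact: ltnW.
    apply: le_lt_trans ar; apply: ler_wpM2l; [exact: exprn_ge0|exact: ltW].
  have dis z : P1 z -> P2 z -> False.
    move=> /BE[x2 [v2 [s2 [x2r v2r s21 /= v2l zE]]]].
    move=> /BE[x3 [v3 [s3 [x3r v3r s31 /= lv3]]]]; rewrite zE => E.
    have p2r : `|(x2, v2)| < r by rewrite ltr_norm_pair x2r.
    have p3r : `|(x3, v3)| < r by rewrite ltr_norm_pair x3r.
    have [|||[_ v23] _] := tube_inj tb p2r p3r _ _ _ E; [lra|lra|lra|].
    by move: v2l; rewrite v23; lra.
  have itv : is_interval (ball y0 e : set R).
    move=> z1 z2 + + z3; rewrite -ball_normE /= !ltr_norml => h1 h2 /andP[h3 h4].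
    lra.
  have y0e : ball y0 e y0 by exact: ballxx.
  have B0 (A : set R) : A 0 -> B A (f t1 (axis y0)).
    move=> A0; rewrite x1E; exists ((x1, 0), 0) => //=.
    by rewrite ltr_norm_pair x1r normr0 r0; split=> //; lra.
  have Bv (A : set R) : A v -> B A (f t1 (axis y)).
    move=> Av; rewrite yE; exists ((x, v), s) => //=.
    by rewrite ltr_norm_pair xr.
  have o1 z : ball y0 e z -> P1 z -> \near z, P1 z.
    by apply: near_level; exact: open_lt.
  have o2 z : ball y0 e z -> P2 z -> \near z, P2 z.
    by apply: near_level; exact: open_gt.
  case: l_between => /andP[l1 l2].
    apply: (dis y); last exact: Bv.
    by apply: (clopen_interval itv cover dis o1 o2 y0e ye); exact: B0.
  apply: (dis y); first exact: Bv.
  apply: (clopen_interval itv _ _ o2 o1 y0e ye); last exact: B0.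
    by move=> z /cover[]; [right|left].
  by move=> z ? ?; exact: (dis z).
apply/nbhs_ballP; exists e => //= y ye.
have [_ /BE[x [v [s [xr vr s1 _ yE]]]] _] := He y ye.
rewrite -(stable_set_flow fl S t1) yE (v0 y x v s)//.
by apply: saddle_stable_axis => //; lra.
Qed.

Hypothesis types : forall O, Os O -> O <> S ->
  attracting_tube f O \/ attracting_tube (reverse_flow f) O.

Let axis_nbhs y0 V : 0 < y0 < r -> nbhs (axis y0) V ->
  \forall y \near y0, V (axis y).
Proof.
move=> y0r Vy; have V0 : nbhs (f 0 (axis y0)) V by rewrite f0.
by apply: filterS (axis_flow_near y0r V0) => y; rewrite f0.
Qed.

Let attracted y := exists O, [/\ Os O, O <> S, attracting_tube f O &
  stable_set f O (axis y)].

(** A point of the axis is in no repelling orbit, since it is wandering. *)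
Lemma saddle_axis_limit y : 0 < y < r ->
  stable_set f S (axis y) \/ attracted y.
Proof.
move=> yr; have [ O OsO yO] := stable_set_cover G (axis y).
have [<-|OS] := pselect (O = S); first by left.
have [at_|rep] := types OsO OS; first by right; exists O.
exfalso; apply: (saddle_unstable_axis_wandering yr).
by rewrite (fo_nonwandering G); exists O => //; exact: (repelling_stable_set G OsO rep).
Qed.

Let itvD : is_interval [set y : R | 0 < y < r].
Proof. by move=> x y /= ? ? z ?; lra. Qed.

Lemma saddle_homoclinic_all y0 : 0 < y0 < r -> stable_set f S (axis y0) ->
  forall y, 0 < y < r -> stable_set f S (axis y).
Proof.
move=> y0r y0S y yr.
apply: (clopen_interval (P2 := attracted) itvD saddle_axis_limit _ _ _ y0r yr y0S).
- by move=> z zS [ O [OsO OS _ zO]]; exact: OS (stable_set_unique G OsO OsS zO zS).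
- by move=> z zr zS; exact: saddle_homoclinic_open.
move=> z zr [ O [OsO OS atO zO]].
apply: filterS (axis_nbhs zr (open_nbhs_nbhs (conj (attracting_tube_open G OsO atO) zO))).
by move=> w; exists O.
Qed.

Let fund_lt y : rho <= y <= b ^+ 2 * rho -> 0 < y < r.
Proof. by slra. Qed.

(** Compactness of the fundamental domain of the axis turns a neighbourhood of each
    of its points into a uniform width. *)
Lemma axis_tube_nbhs (Q : set M) :
  (forall y, rho <= y <= b ^+ 2 * rho -> nbhs (axis y) Q) ->
  exists2 d, 0 < d & forall x y, `|x| < d -> rho <= y <= b ^+ 2 * rho ->
    Q (Phi ((x, y), 0)).
Proof.
move=> HQ.
have cJ : compact `[rho, b ^+ 2 * rho] by exact: segment_compact.
have := (compact_near_coveringP _).1 cJ R (nbhs 0)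
  (fun x y => Q (Phi ((x, y), 0))) _.
case=> [y|d /= d0 Hd].
  rewrite /= in_itv /= => yJ; have yr := fund_lt yJ.
  have pr : `|(0 : R, y)| < r.
    by rewrite ltr_norm_pair normr0 r0 gtr0_norm; case/andP: yr.
  have [e e0 He] := tube_small tb pr (HQ y yJ).
  exists (ball y e, ball 0 e); first by split; exact: nbhsx_ballx.
  move=> [y' x] /=; rewrite -!ball_normE /= => -[ye xe]; apply: He.
  have -> : (x, y') - (0, y) = (x, y' - y) by congr pair; rewrite subr0.
  by rewrite ltr_norm_pair distrC ye andbT; rewrite sub0r normrN in xe.
exists d => // x y xd yJ; apply: Hd; first by rewrite /= sub0r normrN.
by rewrite /= in_itv.
Qed.

(** If the whole half-axis is homoclinic, orbits with any number [N] of visits to a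
    neighbourhood [F] of its fundamental domain are found by induction on [N]:
    in every open set close enough to [S] there is a point off the stable manifold,
    it leaves through [F] so close to the axis that it comes back to the set [W]
    of the previous stage, and there it can be moved slightly to a point with [N]
    further visits. *)
Lemma saddle_no_homoclinic y : 0 < y < r -> ~ stable_set f S (axis y).
Proof.
move=> yr yS; have allS := saddle_homoclinic_all yr yS.
have cJ : compact `[rho, b ^+ 2 * rho] by exact: segment_compact.
have [||F [T [n [oF JF T0 Fn]]]] := bounded_visits (g := axis) fl cJ.
- move=> z; rewrite /= in_itv => /fund_lt zr V; exact: axis_nbhs.
- move=> z; rewrite /= in_itv => /fund_lt; exact: saddle_unstable_axis_wandering.
have [z0 Sz0] := periodic_orbit_neq0 (fo_periodic G OsS).
suff P N : exists W, [/\ open W, S `<=` W & forall U, open U -> U `<=` W ->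
    U !=set0 -> exists2 x, U x & visits f T F N x].
  have [W [oW SW HW]] := P n.
  have [|x _] := HW W oW (fun x h => h); first by exists z0; exact: SW.
  exact: Fn.
elim: N => [|N [W [oW SW HW]]].
  by exists setT; split=> // [|U _ _ [x Ux]]; [exact: openT|exists x => //; exists (fun=> 0)].
pose Q := [set z | F z /\ exists2 t, T <= t & W (f t z)].
have [|d d0 Hd] := @axis_tube_nbhs Q.
  move=> z zJ; have zr := fund_lt zJ.
  have [T1 HT1] := allS z zr W oW SW.
  pose T2 := Num.max T T1.
  have T12 : T1 <= T2 by rewrite le_max lexx orbT.
  have FW : nbhs (axis z) [set w | F w /\ W (f T2 w)].
    apply: filterI; first by apply: open_nbhs_nbhs; split=> //; apply: JF; rewrite /= in_itv.
    by apply: (flow_nbhs fl); apply: open_nbhs_nbhs; split=> //; exact: HT1.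
  apply: filterS FW => w [Fw Ww]; split=> //; exists T2 => //.
  by rewrite le_max lexx.
have [e [e0 er He]] := saddle_exit d0.
have er' : e <= r by slra.
exists (interior (tube_box Phi e)); split; first exact: open_interior.
  exact: (tube_interior_box tb e0 er').
move=> U oU UW [w Uw].
have [[[x y0] s] /= [+ s1] wE] := interior_subset (UW w Uw).
rewrite ltr_norm_pair => /andP[xe y0e].
have [y1 [y1N0 y1e Uy1]] : exists y1, [/\ y1 != 0, `|y1| < e & U (Phi ((x, y1), s))].
  have [y00|y0N0] := eqVneq y0 0; last by exists y0; split=> //; rewrite wE.
  have pr : `|(x, y0)| < r by rewrite ltr_norm_pair; slra.
  have s2 : -2 < s < 2 by lra.
  have : \forall y' \near y0, U (Phi ((x, y'), s)).
    apply: (@continuous_comp _ _ _ (fun y' : R => ((x, y'), s)) Phi y0).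
    - exact: (cvg_pair (cvg_pair (cvg_cst _) cvg_id) (cvg_cst _)).
    - exact: (tube_continuous tb pr s2).
    - by apply: open_nbhs_nbhs; split=> //; rewrite /= wE.
  move=> /nbhs_ballP[e' /= e'0 He'].
  pose y1 := Num.min e e' / 2.
  have m0 : 0 < Num.min e e' by rewrite lt_min e0.
  have y10 : 0 < y1 by rewrite divr_gt0.
  have y1m : y1 < Num.min e e' by rewrite /y1; lra.
  exists y1; split; first by rewrite gt_eqF.
    by rewrite gtr0_norm//; apply: lt_le_trans y1m _; rewrite ge_min lexx.
  apply: He'; rewrite -ball_normE /= y00 sub0r normrN gtr0_norm//.
  by apply: lt_le_trans y1m _; rewrite ge_min lexx orbT.
set z := Phi _ in Uy1.
have [||||t [x' [y' [t0 x'd y'J zE]]]] := He x y1 s; [slra|by rewrite normr_gt0|by []|by []|].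
have [Fz [t2 Tt2 Wz]] := Hd x' y' x'd y'J.
rewrite -zE in Fz Wz; rewrite -fD in Wz.
pose V := interior [set v | W v /\ [set v | U v /\ F (f t v)] (f (- (t2 + t)) v)].
have Vz : V (f (t2 + t) z).
  apply: filterI; first exact: open_nbhs_nbhs.
  apply: (flow_nbhs fl); rewrite (flowK fl); apply: filterI; first exact: open_nbhs_nbhs.
  by apply: (flow_nbhs fl); exact: open_nbhs_nbhs.
have [||v Vv [tau [tau0 tauT]]] := HW V (@open_interior _ _).
- by move=> v /interior_subset[].
- by exists (f (t2 + t) z).
have [_ [Ux Fx]] := interior_subset Vv.
exists (f (- (t2 + t)) v) => //.
exists (fun i => if i is i'.+1 then tau i' + (t2 + t) else t); split=> [[|i] iN|i [|j]//].
- by [].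
- have [ti Fi] := tau0 i iN; split; first lra.
  by rewrite fD (flowNK fl).
case: i => [|i] ij jN; last by have := tauT i j ij jN; lra.
by have [tj _] := tau0 j jN; lra.
Qed.

(** The half-axis is an interval covered by the disjoint open basins of the
    attracting orbits. *)
Lemma saddle_basin : exists A, [/\ Os A, A <> S, attracting_tube f A,
  ~ attracting_tube (reverse_flow f) A &
  forall z, S z -> nbhs z (stable_set f A `|` stable_set f S)].
Proof.
have rhoJ : rho <= rho <= b ^+ 2 * rho by rewrite lexx /= ler_peMl ?ltW.
have rhor' := fund_lt rhoJ.
have att y : 0 < y < r -> attracted y.
  by move=> yr; case: (saddle_axis_limit yr) => // /(saddle_no_homoclinic yr).
have [A [OsA AS atA rhoA]] := att _ rhor'.
exists A; split=> //.
  move=> /(repelling_stable_set G OsA)/(_ _ rhoA) Arho.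
  apply: (saddle_unstable_axis_wandering rhor').
  by rewrite (fo_nonwandering G); exists A.
have opA := attracting_tube_open G OsA atA.
have allA y : 0 < y < r -> stable_set f A (axis y).
  move=> yr.
  apply: (@clopen_interval R [set y | 0 < y < r] [set y | stable_set f A (axis y)]
    [set y | exists O, [/\ Os O, O <> A, attracting_tube f O & stable_set f O (axis y)]]
    _ _ itvD _ _ _ _ rhor' yr rhoA).
  - move=> z /att[ O [OsO OS atO zO]].
    by have [<-|OA] := pselect (O = A); [left|right; exists O].
  - by move=> z zA [ O [OsO OA _ zO]]; exact: OA (stable_set_unique G OsO OsA zO zA).
  - by move=> z zr zA; apply: axis_nbhs => //; exact: open_nbhs_nbhs.
  - move=> z zr [ O [OsO OA atO zO]].
    apply: filterS (axis_nbhs zr (open_nbhs_nbhs (conj (attracting_tube_open G OsO atO) zO))).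
    by move=> w; exists O.
have [|d d0 Hd] := @axis_tube_nbhs (stable_set f A).
  by move=> y /fund_lt/allA yA; exact: open_nbhs_nbhs.
have [e [e0 er He]] := saddle_exit d0.
have er' : e <= r by slra.
move=> z Sz; apply: filterS (tube_box_nbhs tb e0 er' Sz).
move=> _ [[[x y] s] /= [+ s1] <-]; rewrite ltr_norm_pair => /andP[xe ye].
have xr : `|x| < r by slra.
have [y0|yN0] := eqVneq y 0; first by right; rewrite y0; exact: saddle_stable_axis.
left; have [||||t [x' [y' [t0 x'd y'J zE]]]] := He x y s; [by []|by rewrite normr_gt0|by []|by []|].
by rewrite -(stable_set_flow fl A t) zE; exact: Hd.
Qed.

End Saddle.

(** * Uniqueness of the attracting orbit *)

(** Shrinking the neighbourhood away from the other closed orbits leaves a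
    neighbourhood contained in [O]; but [O] is only the core of its tube. *)
Lemma tube_interior_empty {R : realType} {M : topologicalType}
    (f g : R -> M -> M) (Os : set (set M)) (O : set M) T r
    (Phi : (R * R) * R -> M) y : finite_orbit_flow f Os -> Os O ->
  tube g O T r Phi -> O y -> ~ nbhs y (nonwandering f).
Proof.
move=> G OsO tb Oy; rewrite (fo_nonwandering G) => yW.
pose C := \bigcup_(P in Os `\ O) P.
have cC : closed C by apply: (closed_orbits_closed G) => P [].
have yC : nbhs y (~` C).
  apply: open_nbhs_nbhs; split; first exact: closed_openC.
  by move=> [P [OsP PO] Py]; apply: PO; exact: (closed_orbit_unique G OsP OsO Py Oy).
have yO : nbhs y O.
  apply: filterS (filterI yW yC) => z [[P OsP Pz] nCz].
  by have [<-//|PO] := pselect (P = O); case: nCz; exists P.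
have [s s1 yE] := tube_surj tb Oy.
have r0 := tube_gt0 tb; have s2 : -2 < s < 2 by lra.
have pr : `|(0 : R * R)| < r by rewrite normr0.
have : \forall x \near (0 : R), O (Phi ((x, 0), s)).
  apply: (@continuous_comp _ _ _ (fun x : R => ((x, 0 : R), s)) Phi 0).
  - exact: (cvg_pair (cvg_pair cvg_id (cvg_cst _)) (cvg_cst _)).
  - exact: (tube_continuous tb pr s2).
  - by rewrite /= -yE.
move=> /nbhs_ballP[e /= e0 He].
pose x := Num.min e r / 2.
have m0 : 0 < Num.min e r by rewrite lt_min e0.
have x0 : 0 < x by rewrite divr_gt0.
have xm : x < Num.min e r by rewrite /x; lra.
have : O (Phi ((x, 0), s)).
  apply: He; rewrite -ball_normE /= sub0r normrN gtr0_norm//.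
  by apply: lt_le_trans xm _; rewrite ge_min lexx.
have xr : `|(x, 0 : R)| < r.
  rewrite ltr_norm_pair normr0 r0 andbT gtr0_norm//.
  by apply: lt_le_trans xm _; rewrite ge_min lexx orbT.
by move=> /(tube_core tb xr s2)[]; lra.
Qed.

(** The punctured disc is connected: a point is joined to a point of the open
    first quadrant by at most two segments that avoid the centre. *)
Lemma punctured_square_connected {R : realType} (e : R) (P : R * R -> Prop) :
  0 < e ->
  (forall p q, `|p| < e -> `|q| < e -> 0 < p.1 * q.1 \/ 0 < p.2 * q.2 ->
    P p -> P q) ->
  forall p q, p != 0 -> q != 0 -> `|p| < e -> `|q| < e -> P p -> P q.
Proof.
move=> e0 seg; pose h := e / 2.
have h0 : 0 < h by rewrite divr_gt0.
have he : `|h| < e by rewrite gtr0_norm// /h; lra.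
have hhe : `|(h, h)| < e by rewrite ltr_norm_pair he.
have hNe : `|(h, - h)| < e by rewrite ltr_norm_pair normrN he.
have Nhe : `|(- h, h)| < e by rewrite ltr_norm_pair normrN he.
have hh : 0 < h * h by rewrite mulr_gt0.
have both p : p != 0 -> `|p| < e -> (P p -> P (h, h)) /\ (P (h, h) -> P p).
  case: p => x y p0 pe.
  have [x0|x0|x0] := ltrgtP x 0.
  - have xh : 0 < x * - h by rewrite mulrN -mulNr mulr_gt0// oppr_gt0.
    split=> H.
      apply: (seg (- h, h)) => //=; first by right.
      by apply: seg H => //=; left.
    apply: (seg (- h, h)) => //=; first by left; rewrite mulrC.
    by apply: seg H => //=; right.
  - have xh : 0 < x * h by rewrite mulr_gt0.
    by split; apply: seg => //=; left; rewrite // mulrC.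
  have [y0|y0|y0] := ltrgtP y 0.
  - have yh : 0 < y * - h by rewrite mulrN -mulNr mulr_gt0// oppr_gt0.
    split=> H.
      apply: (seg (h, - h)) => //=; first by left.
      by apply: seg H => //=; right.
    apply: (seg (h, - h)) => //=; first by right; rewrite mulrC.
    by apply: seg H => //=; left.
  - have yh : 0 < y * h by rewrite mulr_gt0.
    by split; apply: seg => //=; right; rewrite // mulrC.
  by move: p0; rewrite x0 y0 eqxx.
by move=> p q p0 q0 pe qe /(both p p0 pe).1 /(both q q0 qe).2.
Qed.

Lemma convex_lt {R : realType} (l x y e : R) : 0 <= l <= 1 -> x < e -> y < e ->
  x + l * (y - x) < e.
Proof.
move=> /andP[l0 l1] xe ye; have [xy|yx] := leP x y.
  by have : l * (y - x) <= y - x by [rewrite ler_piMl// subr_ge0]; lra.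
by have : l * (y - x) <= 0 by [rewrite mulr_ge0_le0//; lra]; lra.
Qed.

Lemma convex_neq0 {R : realType} (l x y : R) : 0 <= l <= 1 -> 0 < x * y ->
  x + l * (y - x) != 0.
Proof.
move=> l01 xy0; apply/eqP => H.
have x0 : x != 0 by apply/eqP => x0; move: xy0; rewrite x0 mul0r ltxx.
have Nxx : - (x * x) < 0 by rewrite oppr_lt0 -expr2 exprn_even_gt0.
have Nxy : - (x * y) < 0 by rewrite oppr_lt0.
have := convex_lt l01 Nxx Nxy.
have -> : - (x * x) + l * (- (x * y) - - (x * x)) = - (x * (x + l * (y - x))) by ring.
by rewrite H mulr0 oppr0 ltxx.
Qed.

Lemma convex_norm_lt {R : realType} (l x y e : R) : 0 <= l <= 1 ->
  `|x| < e -> `|y| < e -> `|x + l * (y - x)| < e.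
Proof.
move=> l01; rewrite !ltr_norml => /andP[x1 x2] /andP[y1 y2].
rewrite convex_lt// andbT ltrNl.
have -> : - (x + l * (y - x)) = - x + l * (- y - - x) by ring.
by apply: convex_lt; rewrite // ltrNl.
Qed.

Section Uniqueness.
Context {R : realType} {M : topologicalType} (f : R -> M -> M) (Os : set (set M)).
Hypothesis G : finite_orbit_flow f Os.
Let fl := fo_flow G.

(** Close to the repelling orbit all points off the orbit are wandering, and they
    form a connected set, up to the flow the punctured disc [s = 0]; so one of the
    disjoint open sets [G1] and [G2] contains them all. *)
Lemma repeller_one_side O (G1 G2 : set M) y :
  Os O -> attracting_tube (reverse_flow f) O -> open G1 -> open G2 ->
  (forall x, G1 x -> G2 x -> False) ->
  (forall x, [\/ G1 x, G2 x | nonwandering f x]) ->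
  (forall t x, G1 x -> G1 (f t x)) -> (forall t x, G2 x -> G2 (f t x)) ->
  O y -> nbhs y (G1 `|` nonwandering f) \/ nbhs y (G2 `|` nonwandering f).
Proof.
move=> OsO [T [T' [r [k [L [Phi [_ _ _ _ tb]]]]]]] o1 o2 dis cov inv1 inv2 Oy.
have r0 := tube_gt0 tb.
pose C := \bigcup_(P in Os `\ O) P.
have cC : closed C by apply: (closed_orbits_closed G) => P [].
have s02 : -2 < (0 : R) < 2 by lra.
have O0 := tube_core0 tb s02.
have C0 : nbhs (Phi (0, 0)) (~` C).
  apply: open_nbhs_nbhs; split; first exact: closed_openC.
  by move=> [P [OsP PO] Py]; apply: PO; exact: (closed_orbit_unique G OsP OsO Py O0).
have [|e1 e10 He1] := tube_small tb _ C0; first by rewrite normr0.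
pose e := Num.min e1 r.
have e0 : 0 < e by rewrite lt_min e10.
have er : e <= r by rewrite ge_min lexx orbT.
have GP p : p != 0 -> `|p| < e -> G1 (Phi (p, 0)) \/ G2 (Phi (p, 0)).
  move=> p0 pe; have pr : `|p| < r by exact: lt_le_trans er.
  have [?|?|] := cov (Phi (p, 0)); [by left|by right|].
  rewrite (fo_nonwandering G) => -[P OsP Pp]; exfalso.
  have [PO|PO] := pselect (P = O).
    by move: Pp; rewrite PO => /(tube_core tb pr s02) p00; rewrite p00 eqxx in p0.
  apply: (He1 p); last by exists P.
  by rewrite subr0; apply: lt_le_trans pe _; rewrite ge_min lexx.
have seg (A B : set M) : open A -> open B -> (forall x, A x -> B x -> False) ->
    (forall p, p != 0 -> `|p| < e -> A (Phi (p, 0)) \/ B (Phi (p, 0))) ->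
    forall p q : R * R, `|p| < e -> `|q| < e -> 0 < p.1 * q.1 \/ 0 < p.2 * q.2 ->
    A (Phi (p, 0)) -> A (Phi (q, 0)).
  move=> oA oB AB covAB [x1 y1] [x2 y2] + + pq.
  rewrite !ltr_norm_pair => /andP[x1e y1e] /andP[x2e y2e].
  pose c (l : R) := (x1 + l * (x2 - x1), y1 + l * (y2 - y1)).
  have ce l : 0 <= l <= 1 -> `|c l| < e.
    by move=> l01; rewrite ltr_norm_pair !convex_norm_lt.
  have cN0 l : 0 <= l <= 1 -> c l != 0.
    move=> l01; apply/eqP => -[cx cy].
    by case: pq => /= /(convex_neq0 l01); rewrite ?cx ?cy eqxx.
  have affine (x z : R) : continuous (fun l : R => x + l * (z - x)).
    by move=> l; apply: cvgD; [exact: cvg_cst|apply: cvgM; [exact: cvg_id|exact: cvg_cst]].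
  have cc l : 0 <= l <= 1 -> {for l, continuous (fun l => Phi (c l, 0))}.
    move=> l01; apply: (@continuous_comp _ _ _ (fun l => (c l, 0 : R)) Phi l).
      exact: (cvg_pair (cvg_pair (affine _ _ l) (affine _ _ l)) (cvg_cst _)).
    by apply: (tube_continuous tb) => //; apply: lt_le_trans er; exact: ce.
  have <- : c 0 = (x1, y1) by rewrite /c !mul0r !addr0.
  have <- : c 1 = (x2, y2) by rewrite /c !mul1r; congr pair; ring.
  apply: (@clopen_interval R [set l | 0 <= l <= 1] [set l | A (Phi (c l, 0))]
    [set l | B (Phi (c l, 0))]) => /=.
  - by move=> l1 l2 /= ? ? l3 ?; lra.
  - by move=> l l01; apply: covAB; [exact: cN0|exact: ce].
  - by move=> l; exact: AB.
  - by move=> l l01 Al; apply: (cc l l01); exact: open_nbhs_nbhs.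
  - by move=> l l01 Bl; apply: (cc l l01); exact: open_nbhs_nbhs.
  - by rewrite lexx ler01.
  - by rewrite lexx ler01.
have fill (A : set M) : (forall t x, A x -> A (f t x)) ->
    (forall p, p != 0 -> `|p| < e -> A (Phi (p, 0))) ->
    nbhs y (A `|` nonwandering f).
  move=> inv HA; apply: filterS (tube_box_nbhs tb e0 er Oy).
  move=> _ [[p s] /= [pe s1] <-].
  have pr : `|p| < r by exact: lt_le_trans er.
  have [p0|pN0] := eqVneq p 0.
    right; rewrite (fo_nonwandering G); exists O => //; rewrite p0; apply: (tube_core0 tb); lra.
  left; have [s0|s0] := leP 0 s.
    have [|||t _ ->] := tube_arc tb pr (s := 0) (s' := s); [lra|lra|lra|].
    by apply: inv; exact: HA.
  have [|||t _ tE] := tube_arc tb pr (s := s) (s' := 0); [lra|lra|lra|].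
  have := inv t _ (HA p pN0 pe); rewrite tE /reverse_flow.
  by rewrite (flowNK fl).
have h0 : (e / 2, 0 : R) != 0 by apply/eqP => -[]; lra.
have he : `|(e / 2, 0 : R)| < e.
  by rewrite ltr_norm_pair normr0 e0 gtr0_norm; lra.
have swapG p : p != 0 -> `|p| < e -> G2 (Phi (p, 0)) \/ G1 (Phi (p, 0)).
  by move=> p0 pe; case: (GP p p0 pe); [right|left].
have [Gh|Gh] := GP _ h0 he.
  left; apply: fill => // p p0 pe.
  exact: (punctured_square_connected (P := fun p => G1 (Phi (p, 0))) e0
    (seg _ _ o1 o2 dis GP) h0 p0 he pe Gh).
right; apply: fill => // p p0 pe.
exact: (punctured_square_connected (P := fun p => G2 (Phi (p, 0))) e0
  (seg _ _ o2 o1 (fun x a b => dis x b a) swapG) h0 p0 he pe Gh).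
Qed.

Hypothesis cM : connected [set: M].

(** The sets of points near which [M] is, up to closed orbits, in the basin of [A]
    or the stable set of [S], respectively in the other basins, are open, disjoint
    and cover [M]. *)
Lemma unique_attractor S : Os S -> twisted_saddle_tube f S ->
  (forall O, Os O -> O <> S ->
    attracting_tube f O \/ attracting_tube (reverse_flow f) O) ->
  exists A, [/\ Os A, A <> S, ~ attracting_tube (reverse_flow f) A &
    forall O, Os O -> O <> S -> attracting_tube f O -> O = A].
Proof.
move=> OsS [a [b [r [Phi [a01 b1 tb]]]]] types.
have [A [OsA AS atA nrA SA]] := saddle_basin G OsS a01 b1 tb types.
exists A; split=> // B OsB BS atB; apply: contrapT => BA.
pose G1 := stable_set f A `|` stable_set f S.
pose other O := [/\ Os O, O <> S, O <> A & attracting_tube f O].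
pose G2 := \bigcup_(O in other) stable_set f O.
have inv1 t x : G1 x -> G1 (f t x).
  by case=> ?; [left|right]; rewrite (stable_set_flow fl).
have inv2 t x : G2 x -> G2 (f t x).
  by move=> [ O oO xO]; exists O => //; rewrite (stable_set_flow fl).
have o1 : open G1.
  rewrite openE => x [xA|xS].
    apply: filterS (open_nbhs_nbhs (conj (attracting_tube_open G OsA atA) xA)).
    by move=> ? ?; left.
  apply: (invariant_nbhs fl _ SA xS) => t z.
  by move=> /(inv1 (- t)); rewrite (flowK fl).
have o2 : open G2.
  by apply: bigcup_open => O [OsO _ _ atO]; exact: (attracting_tube_open G).
have dis x : G1 x -> G2 x -> False.
  move=> [xA|xS] [ O [OsO OS OA _] xO].
    exact: OA (stable_set_unique G OsO OsA xO xA).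
  exact: OS (stable_set_unique G OsO OsS xO xS).
have cov x : [\/ G1 x, G2 x | exists2 O, Os O & attracting_tube (reverse_flow f) O /\ O x].
  have [ O OsO xO] := stable_set_cover G x.
  have [OA|OA] := pselect (O = A); first by constructor 1; left; rewrite -OA.
  have [OS|OS] := pselect (O = S); first by constructor 1; right; rewrite -OS.
  have [atO|rep] := types O OsO OS; first by constructor 2; exists O.
  by constructor 3; exists O => //; split=> //; exact: (repelling_stable_set G OsO rep).
have cov' x : [\/ G1 x, G2 x | nonwandering f x].
  have [?|?|[ O OsO [_ Ox]]] := cov x; [by constructor 1|by constructor 2|].
  by constructor 3; rewrite (fo_nonwandering G); exists O.
pose N1 := interior (G1 `|` nonwandering f).
pose N2 := interior (G2 `|` nonwandering f).
have N12 x : N1 x -> N2 x -> False.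
  move=> x1 x2.
  have xW : nbhs x (nonwandering f).
    apply: filterS (filterI x1 x2) => z [[z1|//] [z2|//]]; by case: (dis z).
  have := nbhs_singleton xW; rewrite (fo_nonwandering G) => -[ O OsO Ox].
  have [OS|OS] := pselect (O = S).
    by rewrite OS in Ox; exact: (tube_interior_empty G OsS tb Ox).
  by have [|] := types O OsO OS; move=> [T [T' [r' [k [L [Psi [_ _ _ _ tb']]]]]]];
    exact: (tube_interior_empty G OsO tb' Ox).
have NN x : N1 x \/ N2 x.
  have [x1|x2|[ O OsO [rep Ox]]] := cov x.
  - left; apply: filterS (open_nbhs_nbhs (conj o1 x1)) => z ?; by left.
  - right; apply: filterS (open_nbhs_nbhs (conj o2 x2)) => z ?; by left.
  - exact: (repeller_one_side OsO rep o1 o2 dis cov' inv1 inv2 Ox).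
have [y By] := periodic_orbit_neq0 (fo_periodic G OsB).
have [z Az] := periodic_orbit_neq0 (fo_periodic G OsA).
have N1T : N1 = setT.
  apply: cM.
  - exists z; rewrite /N1; apply: filterS (open_nbhs_nbhs (conj o1 _)).
      by move=> ? ?; left.
    by left; exact: (stable_set_orbit G OsA Az).
  - by exists N1; [exact: open_interior|rewrite setTI].
  - exists N1; last by rewrite setTI.
    have -> : N1 = ~` N2.
      apply/seteqP; split=> x; first by move=> x1 x2; exact: (N12 x).
      by move=> nx2; case: (NN x).
    by apply: open_closedC; exact: open_interior.
apply: (N12 y); first by rewrite N1T.
apply: filterS (open_nbhs_nbhs (conj o2 _)); first by move=> ? ?; left.
by exists B; [split|exact: (stable_set_orbit G OsB By)].
Qed.

End Uniqueness.

(** * Suspensions *)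

Lemma continuous_pair {X Y Z : topologicalType} (g : X -> Y) (h : X -> Z) :
  continuous g -> continuous h -> continuous (fun x => (g x, h x)).
Proof. by move=> cg ch x; exact: (cvg_pair (cg x) (ch x)). Qed.

Lemma continuous_fst_comp {X Y Z : topologicalType} (g : X -> Z) :
  continuous g -> continuous (fun z : X * Y => g z.1).
Proof. by move=> cg z; exact: (continuous_comp (@cvg_fst _ _ _ _ _) (cg z.1)). Qed.

Lemma continuous_snd_comp {X Y Z : topologicalType} (g : Y -> Z) :
  continuous g -> continuous (fun z : X * Y => g z.2).
Proof. by move=> cg z; exact: (continuous_comp (@cvg_snd _ _ _ _ _) (cg z.2)). Qed.

Section SuspensionTopology.
Context {R : realType} {X : topologicalType} (a a' : X -> X).
Hypotheses (ca : continuous a) (ca' : continuous a') (aK : cancel a a')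
  (a'K : cancel a' a).

Let step : X * R -> X * R := susp_step a.
Let back (z : X * R) : X * R := (a' z.1, z.2 + 1).

Let stepK : cancel step back.
Proof. by move=> [x s]; rewrite /back /step /susp_step /= aK subrK. Qed.

Let backK : cancel back step.
Proof. by move=> [x s]; rewrite /back /step /susp_step /= a'K addrK. Qed.

Let step_continuous : continuous step.
Proof.
apply: continuous_pair; first exact: continuous_fst_comp.
apply: (@continuous_snd_comp _ _ _ (fun t : R => t - 1)) => t.
by apply: cvgB; [exact: cvg_id|exact: cvg_cst].
Qed.

Let back_continuous : continuous back.
Proof.
apply: continuous_pair; first exact: continuous_fst_comp.
apply: (@continuous_snd_comp _ _ _ (fun t : R => t + 1)) => t.
by apply: cvgD; [exact: cvg_id|exact: cvg_cst].
Qed.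

Let iter_continuous (g : X * R -> X * R) n : continuous g -> continuous (iter n g).
Proof.
move=> cg; elim: n => [|n IH] z; first exact: cvg_id.
exact: (continuous_comp (IH z) (cg _)).
Qed.

Lemma susp_pi_continuous : continuous (@susp_pi R X a).
Proof. exact: pi_continuous. Qed.

Lemma susp_piP (z w : X * R) : susp_pi a z = susp_pi a w <->
  exists m n : nat, iter m step z = iter n step w.
Proof.
split=> [/eqmodP/asboolP//|H]; exact/eqmodP/asboolP.
Qed.

(** The saturation of [U] is a union of preimages of [U] under integer powers of
    the homeomorphism [step]. *)
Lemma susp_pi_open (U : set (X * R)) : open U -> open (susp_pi a @` U).
Proof.
move=> oU.
have -> : (open (susp_pi a @` U)) = open (susp_pi a @^-1` (susp_pi a @` U)) by [].
have -> : susp_pi a @^-1` (susp_pi a @` U) =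
    \bigcup_m \bigcup_n (iter m step @^-1` (iter n back @^-1` U)).
  have itK n : cancel (iter n step) (iter n back).
    by elim: n => [//|n IH] z; rewrite [iter _ step _]iterS [LHS]iterSr stepK IH.
  have itK' n : cancel (iter n back) (iter n step).
    by elim: n => [//|n IH] z; rewrite [iter _ back _]iterS [LHS]iterSr backK IH.
  apply/seteqP; split=> z.
    move=> [w Uw /susp_piP[n [m E]]]; exists m => //; exists n => //=.
    by rewrite -E itK.
  move=> [m _ [n _ Uz]]; exists (iter n back (iter m step z)) => //.
  by apply/susp_piP; exists n, m; rewrite itK'.
apply: bigcup_open => m _; apply: bigcup_open => n _.
apply: open_comp => [z _|]; first exact: iter_continuous.
by apply: open_comp => // z _; exact: iter_continuous.
Qed.

Lemma iter_step_fst n (z : X * R) : (iter n step z).1 = iter n a z.1.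
Proof. by elim: n => [//|n IH]; rewrite !iterS /= IH. Qed.

Lemma iter_step_snd n (z : X * R) : (iter n step z).2 = z.2 - n%:R.
Proof.
elim: n => [|n IH]; first by rewrite subr0.
by rewrite iterS /= IH -addn1 natrD opprD addrA.
Qed.

Lemma susp_pi_slice x y (s u : R) : -1 < s - u < 1 ->
  susp_pi a (x, s) = susp_pi a (y, u) -> x = y /\ s = u.
Proof.
move=> su /susp_piP[m [n E]].
have := congr1 snd E; rewrite !iter_step_snd /= => E2.
have mn : m = n.
  have d1 : m%:R - n%:R < 1 :> R by lra.
  have d2 : -1 < m%:R - n%:R :> R by lra.
  case: (ltngtP m n) => // mn; exfalso.
    have : m.+1%:R <= n%:R :> R by rewrite ler_nat.
    by rewrite -natr1; lra.
  have : n.+1%:R <= m%:R :> R by rewrite ler_nat.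
  by rewrite -natr1; lra.
have := congr1 fst E; rewrite !iter_step_fst /= mn => E1.
split; last by move: E2; rewrite mn; lra.
by elim: (n) E1 => [//|k IH]; rewrite !iterS => /(can_inj aK).
Qed.

Lemma susp_pi_step x (s : R) : susp_pi a (x, s + 1) = susp_pi a (a x, s).
Proof.
by apply/susp_piP; exists 1%N, 0%N; rewrite /= /step /susp_step /= addrK.
Qed.

Lemma susp_pi_fixed x x0 (s u : R) : a x0 = x0 ->
  susp_pi a (x, s) = susp_pi a (x0, u) -> x = x0.
Proof.
move=> ax0 /susp_piP[m [n E]].
have := congr1 fst E; rewrite !iter_step_fst /=.
have -> : iter n a x0 = x0 by elim: n {E} => [//|n IH]; rewrite iterS IH.
by elim: m {E} => [//|m IH]; rewrite iterS => ax; apply: IH; apply: (can_inj aK); rewrite ax0.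
Qed.

Lemma susp_pi_fixed_slice x0 (s : R) : a x0 = x0 ->
  exists2 u, -1 < u < 1 & susp_pi a (x0, s) = susp_pi a (x0, u).
Proof.
move=> ax0.
have shift n (u : R) : susp_pi a (x0, u + n%:R) = susp_pi a (x0, u).
  elim: n => [|n IH]; first by rewrite addr0.
  by rewrite -natr1 addrA susp_pi_step ax0.
have := floor_le s; have := floorD1_gt s.
case: (Num.floor s) => n; rewrite intrD ?NegzE ?mulrNz -?pmulrn => h1 h2.
  by exists (s - n%:R); [lra|rewrite -[in LHS](subrK n%:R s) shift].
by exists (s + n.+1%:R); [lra|rewrite shift].
Qed.

End SuspensionTopology.

(** * From local equivalence to tubes *)

Section TubeOfEquivalence.
Context {R : realType} {M : topologicalType} (f : R -> M -> M) (O : set M).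
Context (Q : 'M[R]_2) (L : R * R -> 'rV[R]_2) (L' : 'rV[R]_2 -> R * R).
Context (T : R * R -> R * R).
Hypotheses (uQ : Q \in unitmx) (LK : cancel L L') (L'K : cancel L' L).
Hypotheses (cL : continuous L) (cL' : continuous L') (L0 : L 0 = 0).
Hypothesis LT : forall p, linear_plane_map Q (L p) = L (T p).

Let A := linear_plane_map Q.
Let A' := linear_plane_map (invmx Q).
Let AK : cancel A A'. Proof. by move=> x; rewrite /A /A' /linear_plane_map mulmxK. Qed.
Let A'K : cancel A' A. Proof. by move=> x; rewrite /A /A' /linear_plane_map mulmxKV. Qed.

Let mulmx_continuous (B : 'M[R]_2) : continuous (linear_plane_map B).
Proof.
have -> : linear_plane_map B = fun x => x 0 0 *: row 0 B + x 0 1 *: row 1 B.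
  apply/funext => x; apply/rowP => j; rewrite !mxE !big_ord_recl big_ord0 addr0.
  by congr (_ + x _ _ * B _ _); apply/val_inj.
move=> x.
apply: cvgD; first exact: nbhs_filter.
  apply: (@cvgZr_tmp _ _ _ _ _ (fun x : 'rV[R]_2 => x 0 0) (x 0 0)); first exact: nbhs_filter.
  exact: coord_continuous.
apply: (@cvgZr_tmp _ _ _ _ _ (fun x : 'rV[R]_2 => x 0 1) (x 0 1)); first exact: nbhs_filter.
exact: coord_continuous.
Qed.

Let cA := mulmx_continuous (B := Q).
Let cA' := mulmx_continuous (B := invmx Q).
Let A0 : A 0 = 0. Proof. exact: mul0mx. Qed.

Let lift (z : (R * R) * R) : 'rV[R]_2 * R := (L z.1, z.2).
Let drop (z : 'rV[R]_2 * R) : (R * R) * R := (L' z.1, z.2).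
Let liftK : cancel lift drop.
Proof. by move=> [p s]; rewrite /drop /lift /= LK. Qed.
Let dropK : cancel drop lift.
Proof. by move=> [p s]; rewrite /drop /lift /= L'K. Qed.
Let lift_continuous : continuous lift.
Proof.
apply: continuous_pair; first exact: continuous_fst_comp.
by move=> z; exact: cvg_snd.
Qed.
Let drop_continuous : continuous drop.
Proof.
apply: continuous_pair; first exact: continuous_fst_comp.
by move=> z; exact: cvg_snd.
Qed.

Let p0 (z : (R * R) * R) := susp_pi A (lift z).
Let p0_continuous : continuous p0.
Proof.
by move=> z; apply: continuous_comp; [exact: lift_continuous|exact: susp_pi_continuous].
Qed.

Let p0_open (U : set ((R * R) * R)) : open U -> open (p0 @` U).
Proof.
move=> oU; have -> : p0 @` U = susp_pi A @` (drop @^-1` U).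
  apply/seteqP; split=> [_ [z Uz <-]|_ [z Uz <-]].
    by exists (lift z) => //=; rewrite liftK.
  by exists (drop z) => //; rewrite /p0 dropK.
apply: (susp_pi_open cA cA' AK A'K).
by apply: open_comp => // z _; exact: drop_continuous.
Qed.

Let lift0 p : L p = 0 -> p = 0.
Proof. by move=> Lp; rewrite -(LK p) Lp -L0 LK. Qed.

(** The tube is the image under [k] of the tube in the mapping torus. Its radius
    comes from compactness of the range of the flow coordinate: the open set [W]
    contains the core, hence a box around it. *)
Lemma tube_of_equivalence :
  locally_equivalent f O (susp_flow (a := linear_plane_map Q)) (susp_core (Q := Q)) ->
  exists r Phi, tube f O T r Phi.
Proof.
move=> [V [W [h [k [[oV OV] [oW CW] [hV kW kh hk] [ch ck] [hO _ arc]]]]]].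
have ck' w : W w -> {for w, continuous k}.
  move: ck; rewrite continuous_open_subspace// => ck Ww; apply: ck.
  exact/mem_set.
have ch' v : V v -> {for v, continuous h}.
  move: ch; rewrite continuous_open_subspace// => ch Vv; apply: ch.
  exact/mem_set.
have VkW w : W w -> V (k w) by move=> Ww; apply: kW; exists w.
have Wcore s : W (p0 (0, s)).
  by apply: CW; exists s => //; rewrite /p0 /lift /= L0.
have cK : compact `[-2, 2 : R] by exact: segment_compact.
have cov := (compact_near_coveringP _).1 cK (R * R)%type (nbhs (0 : R * R))
  (fun p s => W (p0 (p, s))) _.
have /nbhs_ballP[r /= r0 Hr] : \forall p \near (0 : R * R),
    `[-2, 2] `<=` [set s | W (p0 (p, s))].
  apply: cov => s _.
  have : nbhs (p0 (0, s)) W by apply: open_nbhs_nbhs.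
  move=> /p0_continuous[[U1 U2] /= [n1 n2] HU].
  by exists (U2, U1) => // -[s' p] [/= ? ?]; exact: HU.
have inW p s : `|p| < r -> -2 < s < 2 -> W (p0 (p, s)).
  move=> pr s2; apply: (Hr p); first by rewrite -ball_normE /= sub0r normrN.
  by rewrite /= in_itv /=; lra.
have coreE p s : (susp_core (Q := Q)) (p0 (p, s)) <-> p = 0.
  split=> [[u _ E]|->]; last by exists s => //; rewrite /p0 /lift /= L0.
  by apply: lift0; exact: (susp_pi_fixed AK A0 (esym E)).
pose Phi (z : (R * R) * R) := k (p0 z).
have VPhi p s : `|p| < r -> -2 < s < 2 -> V (Phi (p, s)).
  by move=> pr s2; apply: VkW; exact: inW.
have kinj w w' : W w -> W w' -> k w = k w' -> w = w'.
  by move=> Ww Ww' E; rewrite -(hk w)// E hk.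
exists r, Phi; split=> //.
- move=> p s pr s2; apply: (@continuous_comp _ _ _ p0 k (p, s)).
    exact: p0_continuous.
  exact: ck' (inW p s pr s2).
- move=> p s U pr s2 nU.
  pose D := [set z : (R * R) * R | `|z.1| < r /\ -2 < z.2 < 2].
  have nD : nbhs (p, s) D.
    have np : nbhs p [set q : R * R | `|q| < r].
      apply/nbhs_ballP; exists (r - `|p|); first by rewrite /= subr_gt0.
      move=> q; rewrite -ball_normE /= => pq.
      apply: le_lt_trans (_ : `|p| + `|p - q| < r); last lra.
      by rewrite distrC -[leLHS]/(`|q|) -{1}(subrKC p q); exact: ler_normD.
    exact: (nbhs_pair np (nbhs_itvoo s2)).
  pose E := interior (U `&` D).
  have oE : open E by exact: open_interior.
  have pE : E (p, s) by exact: filterI.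
  have hPhi : h (Phi (p, s)) = p0 (p, s) by rewrite hk//; exact: inW.
  have nh : \forall v \near Phi (p, s), (p0 @` E) (h v).
    apply: (ch' _ (VPhi p s pr s2)); rewrite hPhi.
    by apply: open_nbhs_nbhs; split; [exact: p0_open|exists (p, s)].
  have nV : nbhs (Phi (p, s)) V by apply: open_nbhs_nbhs; split=> //; exact: VPhi.
  apply: filterS (filterI nh nV) => v [[z /interior_subset[Uz _] zv] Vv].
  by exists z => //; rewrite /Phi zv kh.
- move=> p s _ _ _ _; rewrite /Phi /p0 /lift /= (@susp_pi_step R _ A) // .
  by rewrite /A LT.
- move=> p s s' pr s1 ss' s'2.
  have t0 : 0 <= s' - s by rewrite subr_ge0.
  have flowE u : susp_flow u (p0 (p, s)) = p0 (p, s + u) by rewrite /p0 susp_flow_pi.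
  have [u /andP[u0 ut]|alpha [al0 _ inc alE]] := arc (p0 (p, s)) (s' - s) t0.
    by rewrite flowE; apply: inW => //; lra.
  exists (alpha (s' - s)).
    have [<-|ts] := eqVneq 0 (s' - s); first by rewrite al0.
    rewrite -al0; apply/ltW/inc; rewrite ?in_itv /= ?lexx ?t0//.
    by rewrite lt_neqAle ts.
  by rewrite /Phi -alE ?t0 ?lexx// flowE subrKC.
- move=> p s pr s2; rewrite -(coreE p s); have wW := inW p s pr s2.
  split=> [Oz|].
    by rewrite -(hk _ wW) -hO; exists (Phi (p, s)).
  by rewrite -hO => -[y Oy yE]; rewrite /Phi -yE kh//; exact: OV.
- move=> y Oy; have : (susp_core (Q := Q)) (h y) by rewrite -hO; exists y.
  move=> [s _ E].
  have [u u1 uE] := @susp_pi_fixed_slice R _ A 0 s A0.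
  exists u => //; rewrite /Phi /p0 /lift /= L0 -uE E kh//; exact: OV.
- move=> p q s u pr qr s2 u2 su /kinj E.
  have [||E1 ->] := susp_pi_slice AK su (E _ _); [exact: inW|exact: inW|].
  by split=> //; rewrite -(LK p) E1 LK.
Qed.

End TubeOfEquivalence.

(** * Linear coordinates *)

(** Row vectors are multiplied on the right, so this is the action of a lower
    triangular matrix in coordinates. *)
Definition shear_map {R : realType} (a b c : R) (p : R * R) : R * R :=
  (a * p.1 + c * p.2, b * p.2).

Lemma shear_mapK {R : realType} (a b c : R) : a != 0 -> b != 0 ->
  cancel (shear_map a b c) (shear_map a^-1 b^-1 (- c / (a * b))).
Proof.
move=> a0 b0 [x y]; rewrite /shear_map /=; congr pair; field; rewrite ?a0 ?b0//.
Qed.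

Lemma model_matrix_sum {R : realType} (Q : 'M[R]_2) (a b : R) :
  model_matrix Q a b -> \tr Q = a + b /\ \det Q = a * b.
Proof.
move=> [cp _ _ _].
have E : ('X - a%:P) * ('X - b%:P) = 'X^2 - (a + b)%:P * 'X + (a * b)%:P :> {poly R}.
  by rewrite polyCD polyCM; ring.
have := char_poly_trace Q (isT : (0 < 2)%N); have := char_poly_det Q.
rewrite cp E /= !coefE /= => h1 h2; split; lra.
Qed.

(** The row vector [u] is an eigenvector for [a]; on the quotient by its line [Q]
    acts by the other eigenvalue. The second basis vector is free up to
    [w |-> l u + m w], which changes the off-diagonal coefficient. *)
Lemma model_matrix_coordinates {R : realType} (Q : 'M[R]_2) (a b : R) :
  model_matrix Q a b -> exists c0 : R, forall l m, m != 0 ->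
  exists (L : R * R -> 'rV[R]_2) (L' : 'rV[R]_2 -> R * R),
    [/\ cancel L L' /\ cancel L' L, continuous L, continuous L', L 0 = 0 &
        forall p, linear_plane_map Q (L p) = L (shear_map a b ((a - b) * l + c0 * m) p)].
Proof.
move=> mQ; have [trQ _] := model_matrix_sum mQ.
have /eigenvalueP[u uQ u0] : eigenvalue Q a.
  rewrite eigenvalue_root_char; case: mQ => -> _ _ _.
  by rewrite rootE hornerM !hornerXsubC subrr mul0r.
(* A vector [w] independent of [u]: the determinant of the pair is nonzero. *)
have [w uw] : exists w : 'rV[R]_2, u 0 0 * w 0 1 - u 0 1 * w 0 0 != 0.
  have [u00|u00] := eqVneq (u 0 0) 0; last first.
    by exists (delta_mx 0 1); rewrite !mxE /= mulr1 mulr0 subr0.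
  exists (delta_mx 0 0); rewrite !mxE /= mulr0 mulr1 sub0r oppr_eq0.
  apply: contra u0 => /eqP u01; apply/eqP/rowP => j; rewrite mxE.
  by have [->|->] : j = 0 \/ j = 1 by case: j => [[|[|//]] ?]; [left|right]; exact/val_inj.
set d := _ - _ in uw.
pose xc (v : 'rV[R]_2) := (v 0 0 * w 0 1 - v 0 1 * w 0 0) / d.
pose yc (v : 'rV[R]_2) := (u 0 0 * v 0 1 - u 0 1 * v 0 0) / d.
have vE v : v = xc v *: u + yc v *: w.
  apply/rowP => j; rewrite !mxE /xc /yc.
  by have [->|->] : j = 0 \/ j = 1; [case: j => [[|[|//]] ?]; [left|right]; exact/val_inj| |];
    rewrite /d; field.
have xcE al be : xc (al *: u + be *: w) = al by rewrite /xc !mxE /d; field.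
have ycE al be : yc (al *: u + be *: w) = be by rewrite /yc !mxE /d; field.
pose c0 := xc (w *m Q).
have wQ : w *m Q = c0 *: u + b *: w.
  rewrite [LHS]vE; congr (_ + _ *: _).
  have mulE (v : 'rV[R]_2) j : (v *m Q) 0 j = v 0 0 * Q 0 j + v 0 1 * Q 1 j.
    rewrite mxE !big_ord_recl big_ord0 addr0.
    by congr (_ + v _ _ * Q _ _); exact/val_inj.
  have tr2 : \tr Q = Q 0 0 + Q 1 1.
    rewrite /mxtrace !big_ord_recl big_ord0 addr0.
    by congr (_ + Q _ _); exact/val_inj.
  have e0 : u 0 0 * Q 0 0 + u 0 1 * Q 1 0 = a * u 0 0 by rewrite -mulE uQ mxE.
  have e1 : u 0 0 * Q 0 1 + u 0 1 * Q 1 1 = a * u 0 1 by rewrite -mulE uQ mxE.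
  (* The trace of [Q] determines the other diagonal coefficient. *)
  rewrite /yc !mulE; apply: (mulIf uw); rewrite divfK//.
  have -> : b = Q 0 0 + Q 1 1 - a by rewrite -tr2 trQ addrC addKr.
  have -> : u 0 0 * (w 0 0 * Q 0 1 + w 0 1 * Q 1 1) -
      u 0 1 * (w 0 0 * Q 0 0 + w 0 1 * Q 1 0) =
    w 0 0 * (u 0 0 * Q 0 1 + u 0 1 * Q 1 1) - w 0 1 * (u 0 0 * Q 0 0 + u 0 1 * Q 1 0)
    + (Q 0 0 + Q 1 1) * d by rewrite /d; ring.
  by rewrite e0 e1 /d; ring.
exists c0 => l m m0.
pose L (p : R * R) := p.1 *: u + p.2 *: (l *: u + m *: w).
pose L' (v : 'rV[R]_2) := (xc v - l * (yc v / m), yc v / m).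
have LE p : L p = (p.1 + l * p.2) *: u + (m * p.2) *: w.
  by rewrite /L scalerDr !scalerA addrA -scalerDl [l * _]mulrC [m * _]mulrC.
exists L, L'; split.
- split=> [[x y]|v]; first by rewrite /L' LE xcE ycE /=; congr pair; field.
  by rewrite LE /L' /= [RHS]vE; congr (_ *: _ + _ *: _); field; exact: m0.
- move=> p; apply: cvgD.
    by apply: cvgZr_tmp; exact: cvg_fst.
  by apply: cvgZr_tmp; exact: cvg_snd.
- have row_form al be : continuous (fun v : 'rV[R]_2 => v 0 0 * al + v 0 1 * be).
    move=> v; apply: cvgD; first exact: nbhs_filter.
      apply: cvgM; [exact: nbhs_filter|exact: coord_continuous|].
      by apply: cvg_cst; exact: nbhs_filter.
    apply: cvgM; [exact: nbhs_filter|exact: coord_continuous|].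
    by apply: cvg_cst; exact: nbhs_filter.
  apply: continuous_pair.
    suff -> : (fun v => xc v - l * (yc v / m)) = (fun v : 'rV[R]_2 =>
        v 0 0 * (w 0 1 / d + l * u 0 1 / (d * m)) +
        v 0 1 * (- w 0 0 / d - l * u 0 0 / (d * m))) by exact: row_form.
    by apply/funext => v; rewrite /xc /yc; field; rewrite ?uw ?m0.
  suff -> : (fun v => yc v / m) = (fun v : 'rV[R]_2 =>
      v 0 0 * (- u 0 1 / (d * m)) + v 0 1 * (u 0 0 / (d * m))) by exact: row_form.
  by apply/funext => v; rewrite /yc; field; rewrite ?uw ?m0.
- by rewrite /L !scale0r addr0.
- move=> p; rewrite /linear_plane_map !LE mulmxDl -!scalemxAl uQ wQ /shear_map /=.
  by rewrite scalerDr !scalerA addrA -scalerDl; congr (_ *: _ + _ *: _); ring.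
Qed.

(** * The types of closed orbits, in terms of tubes *)

Lemma tube_reverse {R : realType} {M : topologicalType} (f : R -> M -> M) O
    (T T' : R * R -> R * R) r Phi : continuous_flow f -> cancel T' T ->
  tube f O T r Phi ->
  tube (reverse_flow f) O T' r (fun z => Phi (z.1, - z.2)).
Proof.
move=> fl TT' tb.
have neg_continuous : continuous (fun z : (R * R) * R => (z.1, - z.2)).
  apply: continuous_pair; first by move=> z; exact: cvg_fst.
  apply: (@continuous_snd_comp _ _ _ (fun t : R => - t)) => t.
  exact: oppr_continuous.
split.
- exact: tube_gt0 tb.
- move=> p s pr s2; apply: (@continuous_comp _ _ _ _ Phi (p, s)).
    exact: neg_continuous.
  by apply: (tube_continuous tb) => //=; lra.
- move=> p s U pr s2 pU /=.
  have nU : nbhs (p, - s) ((fun z => (z.1, - z.2)) @^-1` U).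
    by apply: neg_continuous; rewrite /= opprK.
  apply: filterS (tube_open tb pr _ nU); last lra.
  by move=> _ [[q u] /= Uq <-]; exists (q, - u) => //=; rewrite opprK.
- move=> p s pr T'pr s2 s1 /=.
  have -> : - s = - (s + 1) + 1 by lra.
  by rewrite (tube_step tb) ?TT'//; lra.
- move=> p s s' pr s2 ss' s'2 /=.
  have [|||t t0 ->] := tube_arc tb pr (s := - s') (s' := - s); [lra|lra|lra|].
  by exists t => //; rewrite /reverse_flow (flowK fl).
- by move=> p s pr s2; apply: (tube_core tb) => //=; lra.
- move=> y Oy; have [s s1 ->] := tube_surj tb Oy.
  by exists (- s); [lra|rewrite /= opprK].
- move=> p q s u pr qr s2 u2 su /= E.
  have [|||-> E'] := tube_inj tb pr qr _ _ _ E; [lra|lra|lra|].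
  by split=> //; lra.
Qed.

Lemma tube_swap {R : realType} {M : topologicalType} (f : R -> M -> M) O
    (T : R * R -> R * R) r Phi (sw := fun p : R * R => (p.2, p.1)) :
  tube f O T r Phi ->
  tube f O (fun p => sw (T (sw p))) r (fun z => Phi (sw z.1, z.2)).
Proof.
move=> tb.
have swK : cancel sw sw by case.
have swn p : `|sw p| = `|p| by case: p => x y; rewrite !prod_normE /= maxC.
have csw : continuous sw.
  apply: continuous_pair; first by move=> z; exact: cvg_snd.
  by move=> z; exact: cvg_fst.
have csw2 : continuous (fun z : (R * R) * R => (sw z.1, z.2)).
  apply: continuous_pair; first exact: continuous_fst_comp.
  by move=> z; exact: cvg_snd.
split.
- exact: tube_gt0 tb.
- move=> p s pr s2; apply: (@continuous_comp _ _ _ _ Phi (p, s)); first exact: csw2.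
  by apply: (tube_continuous tb) => //=; rewrite swn.
- move=> p s U pr s2 pU /=.
  have nU : nbhs (sw p, s) ((fun z => (sw z.1, z.2)) @^-1` U).
    by apply: csw2; rewrite /= swK.
  rewrite -swn in pr.
  apply: filterS (tube_open tb pr s2 nU).
  by move=> _ [[q u] /= Uq <-]; exists (sw q, u) => //=; rewrite swK.
- move=> p s pr Tpr s2 s1 /=; rewrite swK; rewrite swn in Tpr.
  by apply: (tube_step tb); rewrite ?swn.
- by move=> p s s' pr; rewrite -swn in pr; exact: (tube_arc tb pr).
- move=> p s pr s2; rewrite -swn in pr; rewrite (tube_core tb pr s2).
  by split=> [E|->//]; rewrite -(swK p) E.
- by move=> y /(tube_surj tb).
- move=> p q s u pr qr s2 u2 su; rewrite -swn in pr; rewrite -swn in qr.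
  by move=> /(tube_inj tb pr qr s2 u2 su)[E ->]; rewrite -(swK p) E swK.
Qed.

Lemma shear_norm_le {R : realType} (a b c : R) p :
  `|shear_map a b c p| <= Num.max (`|a| + `|c|) `|b| * `|p|.
Proof.
case: p => x y; rewrite /shear_map /= !prod_normE /= ge_max; apply/andP; split.
  apply: le_trans (ler_normD _ _) _; rewrite !normrM.
  apply: le_trans (_ : (`|a| + `|c|) * Num.max `|x| `|y| <= _).
    by rewrite mulrDl lerD// ler_wpM2l// le_max lexx ?orbT.
  by rewrite ler_wpM2r ?le_max ?lexx ?normr_ge0.
rewrite normrM; apply: ler_pM => //; by rewrite le_max lexx orbT.
Qed.

Lemma shear_attracting_tube {R : realType} {M : topologicalType}
    (f : R -> M -> M) O (a b c r : R) Phi :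
  a != 0 -> b != 0 -> `|a| + `|c| < 1 -> `|b| < 1 ->
  tube f O (shear_map a b c) r Phi -> attracting_tube f O.
Proof.
move=> a0 b0 ac1 b1 tb.
exists (shear_map a b c), (shear_map a^-1 b^-1 (- c / (a * b))), r.
exists (Num.max (`|a| + `|c|) `|b|).
exists (Num.max (`|a^-1| + `|- c / (a * b)|) `|b^-1|), Phi; split=> //.
- have ai : a^-1 != 0 by rewrite invr_eq0.
  have bi : b^-1 != 0 by rewrite invr_eq0.
  have := shear_mapK (- c / (a * b)) ai bi; rewrite !invrK.
  suff -> : - (- c / (a * b)) / (a^-1 * b^-1) = c by [].
  by field; rewrite a0 b0.
- by rewrite gt_max ac1 b1 lt_max normr_gt0 b0 orbT.
- by move=> p; exact: shear_norm_le.
- by move=> p; exact: shear_norm_le.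
Qed.

Section Types.
Context {R : realType} {M : topologicalType} (f : R -> M -> M).
Hypothesis fl : continuous_flow f.

(** The free parameters [l] and [m] make the off-diagonal coefficient small for the
    contractions and zero for the saddle. *)
Lemma linear_model_tube O a b : linear_model f O a b ->
  a * b != 0 /\ exists c0, forall l m, m != 0 ->
    exists r Phi, tube f O (shear_map a b ((a - b) * l + c0 * m)) r Phi.
Proof.
move=> [_ [Q mQ le]]; have [_ detQ] := model_matrix_sum mQ.
have det0 : 0 < \det Q by case: mQ.
split; first by rewrite -detQ gt_eqF.
have uQ : Q \in unitmx by rewrite unitmxE unitfE gt_eqF.
have [c0 H] := model_matrix_coordinates mQ; exists c0 => l m m0.
have [L [L' [[LK L'K] cL cL' L0 LT]]] := H l m m0.
exact: (tube_of_equivalence uQ LK L'K cL cL' L0 LT le).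
Qed.

Lemma small_factor (c e : R) : 0 < e -> exists2 m, m != 0 & `|c * m| < e.
Proof.
move=> e0; have c1 : 0 < `|c| + 1 by have := normr_ge0 c; lra.
exists (e / (`|c| + 1)); first by rewrite gt_eqF// divr_gt0.
rewrite normrM (gtr0_norm (divr_gt0 e0 c1)) mulrCA gtr_pMr//.
by rewrite ltr_pdivrMr//; lra.
Qed.

Lemma attracting_linear_model_tube O a b : linear_model f O a b ->
  `|a| < 1 -> `|b| < 1 -> attracting_tube f O.
Proof.
move=> /linear_model_tube[ab0 [c0 H]] a1 b1.
have /norP[a0 b0] : ~~ ((a == 0) || (b == 0)) by rewrite -mulf_eq0.
have [|m m0 mc] := @small_factor c0 (1 - `|a|); first lra.
have [r [Phi]] := H 0 m m0; rewrite mulr0 add0r => tb.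
by apply: shear_attracting_tube tb => //; lra.
Qed.

Lemma repelling_linear_model_tube O a b : linear_model f O a b ->
  1 < `|a| -> 1 < `|b| -> attracting_tube (reverse_flow f) O.
Proof.
move=> /linear_model_tube[ab0 [c0 H]] a1 b1.
have /norP[a0 b0] : ~~ ((a == 0) || (b == 0)) by rewrite -mulf_eq0.
have ai1 : `|a^-1| < 1 by rewrite normfV invf_lt1//; lra.
have bi1 : `|b^-1| < 1 by rewrite normfV invf_lt1//; lra.
have [|m m0 mc] := @small_factor (- c0 / (a * b)) (1 - `|a^-1|); first lra.
have [r [Phi]] := H 0 m m0; rewrite mulr0 add0r => tb.
have ai : a^-1 != 0 by rewrite invr_eq0.
have bi : b^-1 != 0 by rewrite invr_eq0.
have TT' : cancel (shear_map a^-1 b^-1 (- (c0 * m) / (a * b)))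
    (shear_map a b (c0 * m)).
  have := shear_mapK (- (c0 * m) / (a * b)) ai bi; rewrite !invrK.
  suff -> : - (- (c0 * m) / (a * b)) / (a^-1 * b^-1) = c0 * m by [].
  by field; rewrite a0 b0.
apply: (shear_attracting_tube ai bi _ bi1 (tube_reverse fl TT' tb)).
have -> : - (c0 * m) / (a * b) = - c0 / (a * b) * m by field; rewrite a0 b0.
lra.
Qed.

Lemma twisted_saddle_orbit_tube O : twisted_saddle_orbit f O ->
  twisted_saddle_tube f O.
Proof.
move=> [a [b [/linear_model_tube[ab0 [c0 H]] [a1 b1] [a0 b0]]]].
rewrite ltr0_norm// in a1; rewrite ltr0_norm// in b1.
have [r [Phi tb]] := H (- c0 / (a - b)) 1 (oner_neq0 _).
exists a, b, r, Phi; split; [lra|lra|].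
suff -> : saddle_map a b = shear_map a b ((a - b) * (- c0 / (a - b)) + c0 * 1) by [].
apply/funext => -[x y]; rewrite /saddle_map /shear_map /=; congr pair.
by field; apply/eqP; lra.
Qed.

End Types.

(** The reversed flow exchanges the stable and the unstable axis. *)
Lemma twisted_saddle_tube_reverse {R : realType} {M : topologicalType}
    (f : R -> M -> M) O : continuous_flow f -> twisted_saddle_tube f O ->
  twisted_saddle_tube (reverse_flow f) O.
Proof.
move=> fl [a [b [r [Phi [a01 b1 tb]]]]].
have a0 : a != 0 by apply/eqP; lra.
have b0 : b != 0 by apply/eqP; lra.
have TT' : cancel (saddle_map a^-1 b^-1) (saddle_map a b).
  by move=> [x y]; rewrite /saddle_map /=; congr pair; field.
have tb' := tube_swap (tube_reverse fl TT' tb).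
exists b^-1, a^-1, r, (fun z => Phi ((z.1.2, z.1.1), - z.2)); split.
- by rewrite invr_lt0 andbC ltrNl -invrN invf_lt1; lra.
- by rewrite ltrNr -invrN invf_gt1; lra.
- exact: tb'.
Qed.

(** * The three closed orbits *)

Lemma linear_model_sym {R : realType} {M : topologicalType} (f : R -> M -> M) O
    a b : linear_model f O a b -> linear_model f O b a.
Proof.
move=> [pO [Q [cp dQ a1 b1] le]]; split=> //; exists Q => //; split=> //.
by rewrite mulrC.
Qed.

Lemma linear_model_type {R : realType} {M : topologicalType} (f : R -> M -> M)
    O a b : linear_model f O a b ->
  [\/ saddle_orbit f O, attracting_orbit f O | repelling_orbit f O].
Proof.
move=> lm; have [_ [Q [_ _ a1 b1] _]] := lm.
have [ha|ha|ha] := ltrgtP `|a| 1; last by rewrite ha eqxx in a1.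
  have [hb|hb|hb] := ltrgtP `|b| 1; last by rewrite hb eqxx in b1.
    by constructor 2; exists a, b.
  by constructor 1; exists a, b.
have [hb|hb|hb] := ltrgtP `|b| 1; last by rewrite hb eqxx in b1.
  by constructor 1; exists b, a; split=> //; exact: linear_model_sym.
by constructor 3; exists a, b.
Qed.

Theorem lemma1 (R : realType) (M : topologicalType) (At : set (chart R M))
    (f : R -> M -> M) :
  closed_connected_orientable_3manifold At ->
  G1_minus At f ->
  exists S A Rp : set M,
    [/\ saddle_orbit f S, attracting_orbit f A, repelling_orbit f Rp,
        [/\ S <> A, S <> Rp & A <> Rp] &
        nonwandering f = S `|` A `|` Rp].
Proof.
move=> [hM _ kM cM _] [[[f0 fD fc _] _ [Os [fin hyp nw _]]] [S [twS uniqS]]].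
have fl : continuous_flow f by split.
have G : finite_orbit_flow f Os.
  by split=> // O /hyp[].
have pS : periodic_orbit f S by case: twS => a [b [[pS _] _ _]].
have saddleS : saddle_orbit f S by case: twS => a [b [lm ab _]]; exists a, b.
have OsS : Os S.
  have [x Sx] := periodic_orbit_neq0 pS.
  have := periodic_nonwandering fl pS Sx; rewrite nw => -[ O OsO Ox].
  by rewrite (periodic_orbit_eq fl pS (fo_periodic G OsO) Sx Ox).
have types O : Os O -> O <> S -> attracting_orbit f O \/ repelling_orbit f O.
  move=> OsO OS; have [_ _ [a [b lm]]] := hyp O OsO.
  by have [/uniqS//|?|?] := linear_model_type lm; [left|right].
have att O : attracting_orbit f O -> attracting_tube f O.
  by move=> [a [b [lm [a1 b1]]]]; exact: attracting_linear_model_tube lm a1 b1.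
have rep O : repelling_orbit f O -> attracting_tube (reverse_flow f) O.
  by move=> [a [b [lm [a1 b1]]]]; exact: (repelling_linear_model_tube fl lm a1 b1).
have tS := twisted_saddle_orbit_tube twS.
have [|A [OsA AS nrA uniqA]] := unique_attractor G cM OsS tS.
  by move=> O OsO OS; have [/att|/rep] := types O OsO OS; [left|right].
have Gr := finite_orbit_flow_reverse G.
have [|P [OsP PS nrP uniqP]] :=
    unique_attractor Gr cM OsS (twisted_saddle_tube_reverse fl tS).
  rewrite reverse_flowK => O OsO OS.
  by have [/att|/rep] := types O OsO OS; [right|left].
rewrite reverse_flowK in nrP.
have attA : attracting_orbit f A by have [//|/rep] := types A OsA AS.
have repP : repelling_orbit f P by have [/att|//] := types P OsP PS.
exists S, A, P; split=> //.
  by split=> [SA|SP|AP]; [apply: AS|apply: PS|apply: nrP; rewrite -AP; exact: att].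
rewrite nw; apply/seteqP; split=> [x [ O OsO Ox]|x [[Sx|Ax]|Px]].
- have [OS|OS] := pselect (O = S); first by left; left; rewrite -OS.
  have [/att atO|/rep reO] := types O OsO OS.
    by left; right; rewrite -(uniqA O OsO OS atO).
  by right; rewrite -(uniqP O OsO OS reO).
- by exists S.
- by exists A.
- by exists P.
Qed.
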